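(* Let $L>0$, $\Omega=\,]0,L[\,\times\,]0,1[$, and let $k>0$ be a constant with $k\neq \pi l$ for all integers $l\ge 1$. Let $J,\tilde J\ge 1$ be integers and let $0=b_0<b_1<\dots<b_J=L$ and $0=\tilde b_0<\tilde b_1<\dots<\tilde b_{\tilde J}=L$ be two subdivisions with $\tilde b_j\neq b_m$ for all $0<j<\tilde J$ and $0<m<J$. Let $A=-\partial_{xx}^2-\partial_{yy}^2-k^2$ be the Helmholtz operator on $\Omega$ with homogeneous Dirichlet conditions at $y=0$ and $y=1$ and perfect non-reflecting boundary conditions at $x=0$ and $x=L$, and let $P:f\mapsto v+w$ be the double-sweep domain decomposition map associated with the two subdivisions, as defined in the context, where the absorbing layers of all subdomain problems are assumed to be perfectly non-reflecting. Then for every integrable function $f$ on $\Omega$, $$A P f = f ,$$ in the sense defined in the context.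
   Context: **Sine modes.** All functions and distributions in $(x,y)$ are treated mode by mode through the sine expansion in $y$: $u(x,y)=\sum_{l\ge 1}\hat u_l(x)\sin(\pi l y)$. For integrable $f$ on $\Omega$, $\hat f_l(x)=2\int_0^1 f(x,y)\sin(\pi l y)\,dy\in L^1(]0,L[)$. Write $\eta=\pi l$ and $$\lambda=\lambda_l=\begin{cases} i\sqrt{k^2-\eta^2} & \text{if } \eta<k,\\ -\sqrt{\eta^2-k^2} & \text{if } \eta>k,\end{cases}$$ so $\lambda\ne 0$ and $\lambda^2=\eta^2-k^2$. On the $l$-th mode the operator $-\partial_{xx}^2-\partial_{yy}^2-k^2$ acts as $-\partial_{xx}^2+\eta^2-k^2$. **Meaning of $Au=f$ (perfect non-reflecting boundaries).** $Au=f$ means that for every $l\ge1$, $-\partial^2_{xx}\hat u_l+(\eta^2-k^2)\hat u_l=\hat f_l$ in the sense of distributions on $]0,L[$, together with the homogeneous non-reflecting conditions $\partial_x\hat u_l+\lambda\hat u_l=0$ at $x=0$ and $-\partial_x\hat u_l+\lambda\hat u_l=0$ at $x=L$. **Subdomain solves.** The subdomains are $D^{(j)}=\,]b_{j-1},b_j[\,\times\,]0,1[$ for $1\le j\le J$ and $\tilde D^{(j)}=\,]\tilde b_{j-1},\tilde b_j[\,\times\,]0,1[$ for $1\le j\le\tilde J$. Each subdomain is extended in the $x$-direction by absorbing layers (perfectly matched layers, PML) beyond its left and right ends, with the same constant $k$. The corresponding Helmholtz operators are $A^{(j)}$ and $\tilde A^{(j)}$. The layers are assumed to be perfectly non-reflecting: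 solving $A^{(j)}u=F$ or $\tilde A^{(j)}u=F$, for a source $F$ supported in the closure of the subdomain (including point sources in $x$ at its ends), means taking the outgoing solution on the infinite strip $\mathbb R\times\,]0,1[$ with Dirichlet conditions at $y=0,1$, i.e. $$\hat u_l=G_l*\hat F_l,\qquad G_l(x)=\frac{-1}{2\lambda_l}e^{\lambda_l|x|},$$ where $*$ is convolution in $x$ (of distributions when needed). Such a solution $u$ is thus also defined at, and on both sides of, the ends of the subdomain. **Forward sweep.** Let $f^{(j)}=f$ on $D^{(j)}$ and $f^{(j)}=0$ elsewhere. With $v^{(0)}=0$, solve consecutively for $j=1,2,\dots,J$ $$A^{(j)}v^{(j)}=f^{(j)}-2\,\delta(x-b_{j-1})\,\partial_x v^{(j-1)}(b_{j-1},\cdot),$$ and define $v(x,y)=v^{(j)}(x,y)$ for $b_{j-1}<x<b_j$. **Residual.** Let $g=f-Av$, where here $Av$ is obtained by applying the differential operator $-\partial_{xx}^2-\partial_{yy}^2-k^2$ (i.e. mode by mode $-\partial_{xx}^2+\eta^2-k^2$) to $v$ in the sense of distributions on $0<x<L$. The function $v$ may be discontinuous at $x=b_j$, $1\le j\le J-1$, and $g$ is singular only there. Since no interior $\tilde b_j$ coincides with an interior $b_m$, the product $g^{(j)}=I_{\tilde D^{(j)}}\,g$ with the indicator function of $\tilde D^{(j)}$ is well defined. It is extended by zero outside $\tilde D^{(j)}$. **Backward sweep.** With $w^{(\tilde J+1)}=0$, solve consecutively for $j=\tilde J,\tilde J-1,\dots,1$ $$\tilde A^{(j)}w^{(j)}=g^{(j)}+2\,\delta(x-\tilde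 b_j)\,\partial_x w^{(j+1)}(\tilde b_j,\cdot),$$ and define $w(x,y)=w^{(j)}(x,y)$ for $\tilde b_{j-1}<x<\tilde b_j$. **The map $P$.** $Pf=v+w$ (a function defined for almost every $x\in\,]0,L[$ in each mode). *)

(* Defs.v *)
From HB Require Import structures.
From mathcomp Require Export all_boot all_order all_algebra.
From mathcomp Require Export all_classical all_reals all_analysis.
From mathcomp.real_closed Require Export complex.
Export numFieldNormedType.Exports.
Import Order.TTheory GRing.Theory Num.Theory.

Set Implicit Arguments.
Unset Strict Implicit.
Unset Printing Implicit Defensive.

Global Open Scope classical_set_scope.
Global Open Scope ring_scope.
Global Open Scope complex_scope.

Section ComplexValued.
Context {R : realType}.
Implicit Types (z : R[i]) (h : R -> R[i]) (x : R).

Definition cexp z : R[i] :=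
  (expR (complex.Re z) * cos (complex.Im z)) +i*
  (expR (complex.Re z) * sin (complex.Im z)).

Definition cintegrable d (T : measurableType d)
    (mu : {measure set T -> \bar R}) (D : set T) (h : T -> R[i]) : Prop :=
  mu.-integrable D (fun t => (complex.Re (h t))%:E) /\
  mu.-integrable D (fun t => (complex.Im (h t))%:E).

Definition cint (D : set R) h : R[i] :=
  Rintegral lebesgue_measure D (fun x => complex.Re (h x)) +i*
  Rintegral lebesgue_measure D (fun x => complex.Im (h x)).

Definition clocally_integrable (D : set R) h : Prop :=
  locally_integrable D (fun x => complex.Re (h x)) /\
  locally_integrable D (fun x => complex.Im (h x)).

Definition cderivable h x : Prop :=
  derivable (fun t => complex.Re (h t)) x 1 /\
  derivable (fun t => complex.Im (h t)) x 1.

Definition cderive h x : R[i] :=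
  derive1 (fun t => complex.Re (h t)) x +i*
  derive1 (fun t => complex.Im (h t)) x.

Definition ccvg (F : set_system R) h z : Prop :=
  (complex.Re (h x) @[x --> F] --> complex.Re z) /\
  (complex.Im (h x) @[x --> F] --> complex.Im z).

End ComplexValued.

Section Distributions.
Context {R : realType}.
Implicit Types (h : R -> R[i]) (phi psi : R -> R) (a b c : R).

(* phi \in C_c^oo(D), for D open. *)
Definition test (D : set R) phi : Prop :=
  (forall n x, derivable (derive1n n phi) x 1) /\
  (exists K, [/\ compact K, K `<=` D & forall x, ~ K x -> phi x = 0]).

(* A complex-valued distribution is given by its values on real-valued test
   functions, which determine it by C-linearity.  The type carries no
   condition; only values on test functions are meaningful. *)
Definition dist : Type := (R -> R) -> R[i].
Implicit Types (T : dist).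

Definition dist_linear T : Prop := forall (s : R) phi psi,
  test setT phi -> test setT psi ->
  T (fun x => s * phi x + psi x) = s%:C * T phi + T psi.

Definition regular (D : set R) h : dist :=
  fun phi => cint D (fun x => (phi x)%:C * h x).

Definition delta a : dist := fun phi => (phi a)%:C.

Definition ddx T : dist := fun phi => - T (derive1 phi).

(* <h * T, phi> = <h(x), <T(y), phi(x + y)>>, for T with compact support. *)
Definition conv h T : dist :=
  fun phi => cint setT (fun x => h x * T (fun y => phi (x + y))).

Definition represents h T : Prop :=
  clocally_integrable setT h /\
  forall phi, test setT phi -> regular setT h phi = T phi.

Definition density T : R -> R[i] := xget (fun=> 0) [set h | represents h T].

(* h'(a) for a function h known almost everywhere: the classical derivative at
   a of the representative of h that is differentiable around a. *)
Definition deriv_at h a : R[i] :=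
  xget 0 [set z | exists e (u : R -> R[i]), [/\ 0 < e,
    {ae lebesgue_measure, forall x, `|x - a| < e -> h x = u x},
    (forall x, `|x - a| < e -> cderivable u x) & z = cderive u a]].

(* T is the product of the indicator function of ]a, b[ `<=` ]0, L[ with the
   distribution g on ]0, L[, extended by zero to R.  The product makes sense
   when g is an integrable function near the points a and b.  The conditions
   determine T by a partition of unity (whence T is also continuous). *)
Definition is_indicator_mul (L a b : R) (g T : dist) : Prop := [/\
  dist_linear T,
  (forall phi, test `]a, b[ phi -> T phi = g phi),
  (forall phi, test `]-oo, a[ phi \/ test `]b, +oo[ phi -> T phi = 0) &
  forall c, c = a \/ c = b -> exists e h, [/\ 0 < e,
    cintegrable lebesgue_measure `]0, L[ h,
    (forall phi, test (`]c - e, c + e[ `&` `]0, L[) phi ->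
       g phi = regular `]0, L[ h phi) &
    (forall phi, test `]c - e, c + e[ phi -> T phi = regular `]a, b[ h phi)]].

Definition indicator_mul (L a b : R) (g : dist) : dist :=
  xget (fun=> 0) [set T | is_indicator_mul L a b g T].

End Distributions.

Section DoubleSweep.
Context {R : realType}.
Implicit Types (L k : R) (l j J : nat) (f : R * R -> R[i])
  (u : nat -> R -> R[i]).

Definition strip (a b : R) : set (R * R) := `]a, b[ `*` `]0, 1[.

(* Subdivision 0 = b_0 < ... < b_J = L; the values b_j, j > J, are not used. *)
Definition subdivision L J (b : nat -> R) : Prop :=
  [/\ b 0%N = 0, b J = L & forall j, (j < J)%N -> b j < b j.+1].

Definition eta l : R := pi * l%:R.

Definition lam k l : R[i] :=
  if eta l < k then 0 +i* Num.sqrt (k ^+ 2 - eta l ^+ 2)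
  else (- Num.sqrt (eta l ^+ 2 - k ^+ 2))%:C.

Definition mode l f (x : R) : R[i] :=
  2 * cint `]0, 1[ (fun y => (sin (eta l * y))%:C * f (x, y)).

(* - d_xx + eta^2 - k^2 *)
Definition helmholtz k l (T : @dist R) : dist :=
  fun phi => - ddx (ddx T) phi + (eta l ^+ 2 - k ^+ 2)%:C * T phi.

(* u is only defined almost everywhere: its values and derivatives at 0 and L
   are the one-sided limits of those of a differentiable representative. *)
Definition nonreflecting L (lambda : R[i]) (u : R -> R[i]) : Prop :=
  exists (U : R -> R[i]) (p0 q0 pL qL : R[i]), [/\
    {ae lebesgue_measure, forall x, 0 < x < L -> u x = U x},
    (forall x, 0 < x < L -> cderivable U x),
    [/\ ccvg 0^'+ U p0, ccvg 0^'+ (cderive U) q0,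
        ccvg L^'- U pL & ccvg L^'- (cderive U) qL],
    q0 + lambda * p0 = 0 & - qL + lambda * pL = 0].

(* A u = f, where u l is the l-th sine mode of u. *)
Definition helmholtz_solution L k u f : Prop :=
  forall l, (0 < l)%N -> [/\
    clocally_integrable `]0, L[ (u l),
    (forall phi, test `]0, L[ phi ->
       helmholtz k l (regular `]0, L[ (u l)) phi =
       regular `]0, L[ (mode l f) phi) &
    nonreflecting L (lam k l) (u l)].

Definition green k l (x : R) : R[i] :=
  - 1 / (2 * lam k l) * cexp (lam k l * `|x|%:C).

(* The l-th mode of the outgoing solution on the infinite strip. *)
Definition subdomain_solve k l (F : dist) : R -> R[i] :=
  density (conv (green k l) F).

Definition restrict_to (D : set (R * R)) f : R * R -> R[i] :=
  fun z => if z \in D then f z else 0.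

(* forward k b f l j is the l-th mode of v^(j). *)
Fixpoint forward k (b : nat -> R) f l j : R -> R[i] :=
  match j with
  | 0%N => fun=> 0
  | i.+1 => subdomain_solve k l (fun phi =>
      regular setT (mode l (restrict_to (strip (b i) (b i.+1)) f)) phi
      - 2 * deriv_at (forward k b f l i) (b i) * delta (b i) phi)
  end.

(* The function equal to u j on ]b_(j-1), b_j[, 1 <= j <= J. *)
Definition glue J (b : nat -> R) u (x : R) : R[i] :=
  \sum_(i < J) (if b i < x < b i.+1 then u i.+1 x else 0).

Definition residual L k l f (v : R -> R[i]) : dist :=
  fun phi => regular `]0, L[ (mode l f) phi - helmholtz k l (regular `]0, L[ v) phi.

(* backward L k Jt bt g l n is the l-th mode of w^(Jt + 1 - n), g being the
   l-th mode of the residual. *)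
Fixpoint backward L k Jt (bt : nat -> R) (g : dist) l n : R -> R[i] :=
  match n with
  | 0%N => fun=> 0
  | m.+1 => let j := (Jt - m)%N in subdomain_solve k l (fun phi =>
      indicator_mul L (bt j.-1) (bt j) g phi
      + 2 * deriv_at (backward L k Jt bt g l m) (bt j) * delta (bt j) phi)
  end.

(* The l-th sine mode of P f = v + w. *)
Definition double_sweep L k J Jt (b bt : nat -> R) f : nat -> R -> R[i] :=
  fun l x =>
    let v := glue J b (forward k b f l) in
    let g := residual L k l f v in
    let w := glue Jt bt (fun j => backward L k Jt bt g l (Jt.+1 - j)) in
    v x + w x.

End DoubleSweep.

(* Main.v *)
Require Import Defs.
From mathcomp Require Import ring lra measurable_realfun.
Import Order.TTheory GRing.Theory Num.Theory.
Set Implicit Arguments.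
Unset Strict Implicit.
Unset Printing Implicit Defensive.

(** Fix a mode, with its constant lambda.  The kernel
    G(x) = - e^(lambda |x|) / (2 lambda) consists of two waves that leave the
    origin, and so the potential G * F of a source F is a right-going wave
    e^(lambda x) on the right of the support of F, and a left-going wave
    e^(- lambda x) on its left ([potential_right], [potential_left]).  There its
    x-derivative is lambda, respectively - lambda, times its value, which is what
    the non-reflecting conditions and the transmission conditions measure.

    Cut the source along the first subdivision into pieces F_m living on
    ]b_m, b_(m+1)[, and let U be the sum of the potentials G * F_m.  Since G is a
    fundamental solution ([outgoing_fundamental]), U solves the Helmholtz
    equation, and by the preceding remark it satisfies the non-reflecting
    conditions at 0 and L.  The theorem amounts to v + w = U almost everywhere.

    Forward sweep.  The outgoing solution for the point source
    - 2 lambda p delta_b is p e^(lambda |x - b|): on the right of b it continues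
    the right-going wave that has the value p at b.  By induction on the
    subdomains, v^(j) contains the potential of its own piece of the source and
    the right-going waves of all earlier pieces.  What v misses on a subdomain are
    the left-going waves of the later pieces, so v = U - S with
    S = sum_m n_m E_m, where n_m = (G * F_m)(b_m) and
    E_m(x) = e^(lambda (b_m - x)) for x < b_m, E_m(x) = 0 for x > b_m
    ([glue_forward_ae]).

    Residual.  Hence g = A S.  The jumps of E_m and of its derivative at b_m give
    A E_m = delta'_(b_m) - lambda delta_(b_m) ([left_wave_helm]), a monopole and a
    dipole whose outgoing waves cancel on the right: the outgoing solution for
    this source is E_m itself ([solves_dipole]).

    Backward sweep.  The mechanism of the forward sweep, reflected, now applies
    to the point sources of g: w^(j) contains the waves E_m of the b_m lying in its
    subdomain, and the point source at its right end continues the left-going waves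
    of the b_m further right.  As E_m vanishes on the right of b_m, nothing is
    missed this time, and w = S ([glue_backward_ae]).

    Several objects above are defined by what they satisfy: the function that
    represents a distribution, the derivative at a point of a function known almost
    everywhere, the product of a distribution by an indicator function.  To compute
    with them one needs that they are unique: [solves_density], [deriv_atE] and
    [indicator_mulE], which rest on the fundamental lemma of the calculus of
    variations ([vanishing_ae]) and on smooth partitions of unity.  The calculus
    comes down to two facts.  Potentials of integrable functions are differentiated
    under the integral sign, by dominated convergence ([rconv_derive]).  Integrals
    of kernels against test functions have explicit antiderivatives on either side
    of one point ([broken_FTC]). *)

(** * Smooth functions and test functions *)

Section Smooth.
Context {R : realType}.
Implicit Types (f g phi : R -> R) (x : R).

Lemma is_derive1P f x d :
  is_derive x 1 f d <-> derivable f x 1 /\ derive1 f x = d.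
Proof.
rewrite derive1E; split => [[df <-] //|[df <-]]; exact: DeriveDef.
Qed.

Lemma derive1_is f x d : is_derive x 1 f d -> derive1 f x = d.
Proof. by move/is_derive1P => []. Qed.

Lemma derivable_is f x d : is_derive x 1 f d -> derivable f x 1.
Proof. by move/is_derive1P => []. Qed.

Lemma is_derive_near f g x d :
  (\near x, f x = g x) -> is_derive x 1 g d -> is_derive x 1 f d.
Proof.
move=> fg; apply: near_eq_is_derive; rewrite ?oner_eq0//.
by apply: filterS fg => y ->.
Qed.

Definition smooth f := forall n x, derivable (derive1n n f) x 1.

(** Smoothness as a coinductive property: no formula for the higher derivatives of
    a member of S is needed, only that S contains its first derivative. *)
Lemma smooth_coind (S : (R -> R) -> Prop) :
    (forall f, S f -> exists2 g, S g & forall x, is_derive x 1 f (g x)) ->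
  forall f, S f -> smooth f.
Proof.
move=> Sd f Sf; have Sn n : S (derive1n n f).
  elim: n => // n /Sd[g Sg dg]; rewrite derive1nS.
  suff -> : derive1 (derive1n n f) = g by [].
  by apply/funext => x; exact: derive1_is.
by move=> n x; have [g _ dg] := Sd _ (Sn n); exact: derivable_is (dg x).
Qed.

Lemma smooth_derive1 f : smooth f -> smooth (derive1 f).
Proof. by move=> sf n x; rewrite -derive1Sn; exact: sf. Qed.

Lemma smooth_is_derive f x : smooth f -> is_derive x 1 f (derive1 f x).
Proof. by move=> /(_ 0%N x) df; apply/is_derive1P. Qed.

(** Closing the smooth functions under the field operations gives a class that is
    stable under differentiation, whence all the closure properties of smoothness
    at once, without the Leibniz formula. *)
Inductive elementary : (R -> R) -> Prop :=
| elem_smooth f : smooth f -> elementary f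
| elem_add f g : elementary f -> elementary g -> elementary (fun x => f x + g x)
| elem_mul f g : elementary f -> elementary g -> elementary (fun x => f x * g x)
| elem_inv f : elementary f -> (forall x, f x != 0) -> elementary (fun x => (f x)^-1)
| elem_aff f a b : elementary f -> elementary (fun x => f (a * x + b)).

Lemma smooth_cst (c : R) : smooth (fun=> c).
Proof.
apply: (@smooth_coind (fun f => exists c, f = fun=> c)); last by exists c.
move=> _ [{}c ->]; exists (fun=> 0); first by exists 0.
by move=> x; exact: is_derive_cst.
Qed.

Lemma elementary_smooth f : elementary f -> smooth f.
Proof.
move: f; apply: smooth_coind => f; elim => {f}.
- move=> f sf; exists (derive1 f); last by move=> x; exact: smooth_is_derive.
  exact/elem_smooth/smooth_derive1.
- move=> f g ef [f' ef' df] eg [g' eg' dg]; exists (fun x => f' x + g' x).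
    exact: elem_add.
  by move=> x; exact: is_deriveD.
- move=> f g ef [f' ef' df] eg [g' eg' dg].
  exists (fun x => f x * g' x + g x * f' x).
    by apply: elem_add; exact: elem_mul.
  by move=> x; exact: is_deriveM.
- move=> f ef [f' ef' df] f0.
  exists (fun x => ((f x)^-1 * (f x)^-1) * ((fun=> -1) x * f' x)).
    have ei : elementary (fun x => (f x)^-1) by exact: elem_inv.
    by apply: elem_mul; apply: elem_mul => //; exact/elem_smooth/smooth_cst.
  move=> x; have := is_deriveV (f0 x) (df x).
  move/is_derive_eq; apply; rewrite /GRing.scale/= exprSr expr1 invfM; ring.
- move=> f a b ef [f' ef' df]; exists (fun x => f' (a * x + b) * (fun=> a) x).
    apply: elem_mul; last exact/elem_smooth/smooth_cst.
    exact: elem_aff.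
  move=> x; apply: (@is_derive1_comp _ f (fun x => a * x + b)) => //.
  have h : is_derive x 1 (fun x => a * x + b) (a *: 1 + 0).
    by apply: is_deriveD.
  by move/is_derive_eq: h; apply; rewrite /GRing.scale/= mulr1 addr0.
Qed.

Lemma exp_ge_pow (n : nat) (u : R) : 0 <= u -> u ^+ n * expR (- u) <= n`!%:R.
Proof.
move=> u0; rewrite expRN ler_pdivrMr ?expR_gt0// mulrC -ler_pdivrMr ?ltr0n ?fact_gt0//.
case: n => [|n]; first by rewrite expr0 fact0 divr1 -expR0 ler_expR.
by apply: le_trans (expR_ge1Dxn n u0); rewrite lerDr.
Qed.

Lemma poly_expN_bounded (p : {poly R}) :
  exists2 C : R, 0 <= C & forall u : R, 0 <= u -> `|p.[u]| * expR (- u) <= C.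
Proof.
exists (\sum_(i < size p) `|p`_i| * i`!%:R).
  by apply: sumr_ge0 => i _; rewrite mulr_ge0.
move=> u u0; rewrite horner_coef.
apply: (@le_trans _ _ ((\sum_(i < size p) `|p`_i| * u ^+ i) * expR (- u))).
  rewrite ler_wpM2r ?expR_ge0//; apply: le_trans (ler_norm_sum _ _ _) _.
  by apply: ler_sum => i _; rewrite normrM normrX (ger0_norm u0).
rewrite mulr_suml; apply: ler_sum => i _; rewrite -mulrA ler_wpM2l//.
exact: exp_ge_pow.
Qed.

(** The functions p(1/x) e^(-1/x): the derivatives of e^(-1/x) all have this form,
    with another polynomial p. *)
Definition flat_exp (p : {poly R}) x : R :=
  if 0 < x then p.[x^-1] * expR (- x^-1) else 0.

(** The factor 1/x in a difference quotient at 0 only changes p into p X, so this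
    bound is what gives the derivative 0 at the origin. *)
Lemma flat_exp_linear_bound p : exists2 C : R, 0 <= C &
  forall x, `|flat_exp p x| <= C * `|x|.
Proof.
have [C C0 Cp] := poly_expN_bounded (p * 'X); exists C => // x.
rewrite /flat_exp; case: ifPn => [x0|_]; last by rewrite normr0 mulr_ge0.
have /Cp : 0 <= x^-1 by rewrite invr_ge0 ltW.
rewrite hornerMX normrM normrM (ger0_norm (expR_ge0 _)) -ler_pdivrMr ?normr_gt0 ?gt_eqF//.
by rewrite normfV mulrAC.
Qed.

Lemma is_derive_flat_exp p x :
  is_derive x 1 (flat_exp p) (flat_exp ('X ^+ 2 * (p - p^`())) x).
Proof.
have [x0|x0|<-] := ltgtP 0 x; last first.
- have -> : flat_exp ('X ^+ 2 * (p - p^`())) 0 = 0 by rewrite /flat_exp ltxx.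
  have [C C0 Cp] := flat_exp_linear_bound (p * 'X).
  have F0 : flat_exp p 0 = 0 by rewrite /flat_exp ltxx.
  have lim0 : h^-1 *: (flat_exp p (h *: 1 + 0) - flat_exp p 0) @[h --> 0^'] --> 0.
    apply/cvgr0Pnorm_le => e e0; near=> h.
    have h0 : h != 0 by near: h; exact: nbhs_dnbhs_neq.
    rewrite F0 subr0 addr0 /GRing.scale/= mulr1.
    apply: (@le_trans _ _ (C * `|h|)).
      apply: le_trans (Cp h); rewrite /flat_exp; case: ifPn => h1; last by rewrite mulr0.
      by rewrite hornerMX !normrM (mulrC `|h^-1|) mulrAC.
    apply: (@le_trans _ _ ((C + 1) * `|h|)); first by rewrite ler_wpM2r// lerDl.
    by rewrite -ler_pdivlMl ?ltr_wpDl// mulrC; near: h; apply: dnbhs0_le; rewrite divr_gt0// ltr_wpDl.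
  apply/is_derive1P; split; first by apply/cvg_ex; exists 0.
  by rewrite derive1E; apply/cvg_lim.
- apply: (is_derive_near (g := fun=> 0)); last first.
    by rewrite /flat_exp ltNge (ltW x0)/=; exact: is_derive_cst.
  near=> y; rewrite /flat_exp ltNge; case: leP => // y0.
  suff : y < 0 by rewrite ltNge (ltW y0).
  by near: y; exact: lt_nbhsl.
- apply: (is_derive_near (g := fun y => p.[y^-1] * expR (- y^-1))).
    near=> y; rewrite /flat_exp; case: ifPn => //; rewrite -leNgt leNgt.
    by move=> /negP; case; near: y; exact: lt_nbhsr.
  rewrite /flat_exp x0.
  have xn0 : x != 0 by rewrite gt_eqF.
  have di : is_derive x 1 (fun y : R => y^-1) (- x ^- 2).
    have := is_deriveV (xn0 : id x != 0) (is_derive_id x 1).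
    by move/is_derive_eq; apply; rewrite /GRing.scale/= mulr1.
  have dp := @is_derive1_comp _ (horner p) _ x _ _ (is_derive_poly _ _) di.
  have de := @is_derive1_comp _ expR (fun y => - y^-1) x _ _ (is_derive_expR _) (is_deriveN di).
  have := @is_deriveM _ _ _ _ _ _ _ _ dp de.
  move/is_derive_eq; apply; rewrite /GRing.scale/=.
  rewrite !hornerE /= -exprVn.
  by set u := x^-1; set a := p.[u]; set b := _.[u]; set c := expR _; rewrite /= opprK; ring.
Unshelve. all: by end_near. Qed.

Lemma smooth_flat_exp p : smooth (flat_exp p).
Proof.
apply: (@smooth_coind (fun f => exists q, f = flat_exp q)); last by exists p.
move=> _ [q ->]; exists (flat_exp ('X ^+ 2 * (q - q^`()))); first by eexists.
by move=> x; exact: is_derive_flat_exp.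
Qed.

(** With E(x) = e^(-1/x) for x > 0 and E(x) = 0 otherwise, the quotient
    E(x - p) / (E(x - p) + E(q - x)) has the required values, and its denominator
    never vanishes. *)
Lemma smooth_step (p q : R) : p < q -> exists s : R -> R,
  [/\ smooth s, forall x, x <= p -> s x = 0, forall x, q <= x -> s x = 1
    & forall x, 0 <= s x <= 1].
Proof.
move=> pq; pose E := flat_exp 1.
have E_ge0 x : 0 <= E x.
  by rewrite /E /flat_exp; case: ifPn => // _; rewrite hornerC mul1r expR_ge0.
have E_gt0 x : 0 < x -> 0 < E x.
  by rewrite /E /flat_exp => ->; rewrite hornerC mul1r expR_gt0.
have E0 x : x <= 0 -> E x = 0 by rewrite /E /flat_exp leNgt; case: ifPn.
pose D x := E (1 * x + - p) + E (-1 * x + q).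
have D_gt0 x : 0 < D x.
  rewrite /D; have [xq|qx] := ltP x q.
    by rewrite ltr_wpDl// E_gt0// mulN1r addrC subr_gt0.
  by rewrite ltr_pwDl// E_gt0// mul1r subr_gt0 (lt_le_trans pq).
exists (fun x => E (1 * x + - p) * (D x)^-1); split.
- have eE : elementary E by exact/elem_smooth/smooth_flat_exp.
  apply: elementary_smooth; apply: elem_mul; first exact: elem_aff.
  apply: elem_inv => [|x]; last by rewrite gt_eqF.
  by apply: elem_add; exact: elem_aff.
- by move=> x xp; rewrite E0 ?mul0r// mul1r subr_le0.
- move=> x qx; rewrite /D (E0 (-1 * x + q)) ?addr0 ?mulfV//.
    by rewrite gt_eqF// E_gt0// mul1r subr_gt0 (lt_le_trans pq).
  by rewrite mulN1r addrC subr_le0.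
- move=> x; rewrite divr_ge0 ?(ltW (D_gt0 x))//= ler_pdivrMr// mul1r.
  by rewrite [leRHS]mul1r /D mul1r lerDl.
Qed.

Lemma smoothM f g : smooth f -> smooth g -> smooth (fun x => f x * g x).
Proof. by move=> sf sg; apply: elementary_smooth; apply: elem_mul; exact: elem_smooth. Qed.

Lemma smoothD f g : smooth f -> smooth g -> smooth (fun x => f x + g x).
Proof. by move=> sf sg; apply: elementary_smooth; apply: elem_add; exact: elem_smooth. Qed.

Lemma smoothZ f (c : R) : smooth f -> smooth (fun x => c * f x).
Proof. by move=> sf; exact (smoothM (@smooth_cst c) sf). Qed.

Lemma smoothB f g : smooth f -> smooth g -> smooth (fun x => f x - g x).
Proof.
move=> sf sg; have := smoothD sf (@smoothZ _ (-1) sg); congr smooth.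
by apply/funext => x; rewrite mulN1r.
Qed.

Lemma smooth_shift f (a : R) : smooth f -> smooth (fun x => f (a + x)).
Proof.
move=> sf; have : smooth (fun x => f (1 * x + a)).
  by apply: elementary_smooth; apply: elem_aff; exact: elem_smooth.
by congr smooth; apply/funext => x; rewrite mul1r addrC.
Qed.

Lemma smooth_continuous f : smooth f -> continuous f.
Proof.
move=> sf x; apply: differentiable_continuous; apply/derivable1_diffP.
exact: (sf 0%N).
Qed.

Lemma derive1_lin f g (c : R) x : smooth f -> smooth g ->
  derive1 (fun x => c * f x + g x) x = c * derive1 f x + derive1 g x.
Proof.
move=> sf sg; apply: derive1_is; apply: is_deriveD; last exact: smooth_is_derive.
have := is_deriveZ c (smooth_is_derive x sf); exact.
Qed.

Lemma derive1_shift f (a : R) x : smooth f ->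
  derive1 (fun y => f (a + y)) x = derive1 f (a + x).
Proof.
move=> sf; apply: derive1_is.
rewrite -[X in is_derive _ _ _ X]mulr1.
apply: (@is_derive1_comp _ f (fun y => a + y)); first exact: smooth_is_derive.
have h : is_derive x 1 (fun y => a + y) (0 + 1) by apply: is_deriveD.
by rewrite add0r in h.
Qed.

Implicit Types (D : set R).

Lemma test_smooth D phi : test D phi -> smooth phi. Proof. by case. Qed.

Lemma testS D D' phi : D `<=` D' -> test D phi -> test D' phi.
Proof. by move=> DD [sp [K [cK KD K0]]]; split => //; exists K; split => // x /KD /DD. Qed.

Lemma testT D phi : test D phi -> test setT phi.
Proof. exact: testS. Qed.

Lemma test_out D phi x : test D phi -> ~ D x -> phi x = 0.
Proof. by move=> [_ [K [_ KD +]]] Dx; apply=> /KD. Qed.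

Lemma test_derive1 D phi : test D phi -> test D (derive1 phi).
Proof.
move=> [sp [K [cK KD K0]]]; split; first exact: smooth_derive1.
exists K; split => // x Kx.
have oK : open (~` K) by apply: closed_openC; exact: compact_closed.
apply: derive1_is; apply: (is_derive_near (g := fun=> 0)).
by apply: filterS (open_nbhs_nbhs (conj oK Kx)) => y; exact: K0.
Qed.

Lemma test_bounded_supp phi : test setT phi ->
  exists2 M : R, 0 < M & forall x, M <= `|x| -> phi x = 0.
Proof.
move=> [_ [K [/compact_bounded[M [_ MK]] _ K0]]].
exists (Num.max 1 (M + 2)); first by rewrite lt_max ltr01.
move=> x; rewrite ge_max => /andP[_ Mx]; apply: K0 => Kx.
have := MK (M + 1); rewrite ltrDl ltr01 => /(_ isT _ Kx)/= /(le_trans Mx).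
by rewrite lerD2l leNgt (ltr_nat _ 1 2).
Qed.

Lemma test_lin D phi psi (c : R) : test D phi -> test D psi ->
  test D (fun x => c * phi x + psi x).
Proof.
move=> [sp [K [cK KD K0]]] [sp' [K' [cK' KD' K0']]]; split.
  exact: (smoothD (@smoothZ _ c sp) sp').
exists (K `|` K'); split; first exact: compactU.
  by rewrite subUset.
by move=> x /not_orP[Kx Kx']; rewrite K0// K0'// mulr0 addr0.
Qed.

Lemma test_shift phi (a : R) : test setT phi -> test setT (fun x => phi (a + x)).
Proof.
move=> tp; have [M M0 Mp] := test_bounded_supp tp.
split; first exact/smooth_shift/(test_smooth tp).
exists `[-(M + `|a|), M + `|a|]%classic; split => //; first exact: segment_compact.
move=> x; rewrite /= in_itv/= -ler_norml => /negP; rewrite -ltNge => xM.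
apply: Mp; rewrite addrC -[a]opprK; apply: le_trans (lerB_dist _ _).
by rewrite normrN lerBrDr ltW.
Qed.

(** Multiplication by a cutoff moves the support of a test function into D; this
    is how partitions of unity enter. *)
Lemma test_mul D phi s (K : set R) : test setT phi -> smooth s -> closed K ->
  K `<=` D -> (forall x, ~ K x -> s x = 0) -> test D (fun x => s x * phi x).
Proof.
move=> [sp [K' [cK' _ K'0]]] ss cK KD K0; split; first exact: (smoothM ss sp).
exists (K' `&` K); split.
- by apply: compact_closedI.
- by move=> x [_ /KD].
by move=> x /not_andP[/K'0->|/K0->]; rewrite ?mulr0 ?mul0r.
Qed.

End Smooth.

(** * Integrals of real functions *)

Section RealIntegrable.
Context d (T : measurableType d) {R : realType} (mu : {measure set T -> \bar R}).
Implicit Types (D : set T) (f g : T -> R).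

Lemma rintegrableD D f g : measurable D ->
  mu.-integrable D (EFin \o f) -> mu.-integrable D (EFin \o g) ->
  mu.-integrable D (EFin \o (fun x => f x + g x)).
Proof. by move=> mD fi gi; exact: (integrableD mD fi gi). Qed.

Lemma rintegrableZ D f (c : R) : measurable D ->
  mu.-integrable D (EFin \o f) -> mu.-integrable D (EFin \o (fun x => c * f x)).
Proof. by move=> mD fi; exact: (integrableZl mD c fi). Qed.

Lemma rintegrableB D f g : measurable D ->
  mu.-integrable D (EFin \o f) -> mu.-integrable D (EFin \o g) ->
  mu.-integrable D (EFin \o (fun x => f x - g x)).
Proof. by move=> mD fi gi; exact: (integrableB mD fi gi). Qed.

Lemma rintegrable_bounded D f g (C : R) : measurable D ->
  measurable_fun D f -> (forall x, `|f x| <= C) ->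
  mu.-integrable D (EFin \o g) -> mu.-integrable D (EFin \o (fun x => f x * g x)).
Proof.
move=> mD mf fC gi; refine (integrableMr mD mf _ gi).
exists C; split; first exact: num_real.
by move=> M CM x _ /=; apply: le_trans (fC x) _; exact: ltW.
Qed.

Lemma rintegrable_fun_bounded D f (C : R) : measurable D -> (mu D < +oo)%E ->
  measurable_fun D f -> (forall x, `|f x| <= C) -> mu.-integrable D (EFin \o f).
Proof.
move=> mD Dlt mf fC; apply: measurable_bounded_integrable => //.
exists C; split; first exact: num_real.
by move=> M CM x _ /=; apply: le_trans (fC x) _; exact: ltW.
Qed.

End RealIntegrable.

Section FundamentalLemma.
Context {R : realType}.
Implicit Types (h phi : R -> R) (D : set R).
Local Notation mu := (@lebesgue_measure R).

Lemma Rintegral_support (A : set R) (h : R -> R) : (forall x, ~ A x -> h x = 0) ->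
  Rintegral mu setT h = Rintegral mu A h.
Proof.
move=> h0; rewrite [RHS]Rintegral_mkcond; apply: eq_Rintegral => x _.
by rewrite patchE; case: ifPn => // /negP; rewrite inE; exact: h0.
Qed.

Lemma locally_integrable_itv h (a b : R) : locally_integrable setT h ->
  mu.-integrable `[a, b] (EFin \o h).
Proof.
move=> [mh _ ih]; apply/integrableP; split.
  by apply/measurable_EFinP; exact: measurable_funTS.
by apply: ih => //; exact: segment_compact.
Qed.

Lemma plateau (D : set R) (x r : R) : 0 < r -> `[x - r, x + r] `<=` D ->
  exists phi, [/\ test D phi, forall y, 0 <= phi y <= 1,
    forall y, ~ ball x r y -> phi y = 0 &
    forall y, x - r / 2 <= y <= x + r / 2 -> phi y = 1].
Proof.
move=> r0 rD.
have [s1 [ss1 s10 s11 s1b]] := @smooth_step R (x - r) (x - r / 2) ltac:(lra).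
have [s2 [ss2 s20 s21 s2b]] := @smooth_step R (x + r / 2) (x + r) ltac:(lra).
exists (fun y => s1 y * (1 - s2 y)); split.
- split; first by apply: (smoothM ss1); exact: (smoothB (@smooth_cst _ 1) ss2).
  exists `[x - r, x + r]%classic; split => //; first exact: segment_compact.
  move=> y /=; rewrite in_itv/= => /negP; rewrite negb_and -!ltNge => /orP[yx|yx].
    by rewrite s10 ?mul0r// ltW.
  by rewrite s21 ?subrr ?mulr0// ltW.
- move=> y; have /andP[a1 b1] := s1b y; have /andP[a2 b2] := s2b y.
  by rewrite mulr_ge0 ?subr_ge0//= mulr_ile1 ?subr_ge0// lerBlDr lerDl.
- move=> y; rewrite ball_itv/= in_itv/= => /negP; rewrite negb_and -!leNgt => /orP[yx|yx].
    by rewrite s10 ?mul0r.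
  by rewrite s21 ?subrr ?mulr0.
- by move=> y /andP[y1 y2]; rewrite s11// s20// subr0 mulr1.
Qed.

(** At a Lebesgue point x where h(x) <> 0, a plateau function supported in a small
    ball gives a contradiction: the integral of phi h is h(x) times the integral of
    phi, up to an error which is small compared with the radius, whereas the
    integral of phi is at least the radius. *)
Lemma vanishing_ae D h : open D -> locally_integrable setT h ->
  (forall phi, test D phi -> Rintegral mu setT (fun x => phi x * h x) = 0) ->
  {ae mu, forall x, D x -> h x = 0}.
Proof.
move=> oD lh h0; have := lebesgue_differentiation lh.
apply: filterS; first exact: (ae_filter_ringOfSetsType mu).
move=> x Lx Dx; apply/eqP; apply: contraT; rewrite -normr_gt0.
set c := `|h x| => c0.
have /open_nbhs_nbhs/nbhs_ballP[e /= e0 eD] : open_nbhs x D by [].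
(* r is small enough for the mean oscillation of h over the ball to be below |h(x)| / 4. *)
near (0 : R)^'+ => r.
have r0 : 0 < r by near: r; exact: nbhs_right_gt.
have rD : `[x - r, x + r] `<=` D.
  move=> y /=; rewrite in_itv/= => /andP[y1 y2]; apply: eD.
  rewrite ball_itv/= in_itv/=.
  have re : r < e by near: r; exact: nbhs_right_lt.
  by apply/andP; split; lra.
have dav : (davg h x r < (c / 4)%:E)%E.
  near: r.
  have n0 : nbhs (0%E : \bar R) [set y | (y < (c / 4)%:E)%E].
    apply: open_nbhs_nbhs; split; first exact: open_ereal_lt_ereal.
    by rewrite /= lte_fin divr_gt0.
  exact: (Lx _ n0).
have [phi [tphi phib phi0 phi1]] := plateau r0 rD.
have := h0 _ tphi; rewrite (Rintegral_support (A := ball x r)); last first.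
  by move=> y /phi0->; rewrite mul0r.
have mB := @measurable_ball R x r.
have muB : mu (ball x r) = (r *+ 2)%:E by rewrite lebesgue_measure_ball// ltW.
have ih : mu.-integrable (ball x r) (EFin \o h).
  have ii := @locally_integrable_itv h (x - r) (x + r) lh.
  refine (@integrableS _ _ _ mu _ _ _ _ mB _ ii) => //.
  by rewrite ball_itv; exact: subset_itv_oo_cc.
have mphi : measurable_fun (ball x r) phi.
  apply: measurable_funTS; apply: continuous_measurable_fun.
  by apply: smooth_continuous; exact: test_smooth tphi.
have phi_le1 y : `|phi y| <= 1.
  by have /andP[p0 p1] := phib y; rewrite ger0_norm.
have Blt : (mu (ball x r) < +oo)%E by rewrite muB ltry.
have iphi : mu.-integrable (ball x r) (EFin \o phi).
  exact: (@rintegrable_fun_bounded _ _ _ mu _ _ 1).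
have ihx : mu.-integrable (ball x r) (EFin \o (fun y => h y - h x)).
  apply: (@rintegrableB _ _ _ mu) => //.
  exact: (@rintegrable_fun_bounded _ _ _ mu _ _ `|h x|).
have ip : mu.-integrable (ball x r) (EFin \o (fun y => phi y * (h y - h x))).
  exact: (@rintegrable_bounded _ _ _ mu _ _ _ 1).
have -> : Rintegral mu (ball x r) (fun y => phi y * h y) =
    Rintegral mu (ball x r) (fun y => phi y * (h y - h x)) + h x * Rintegral mu (ball x r) phi.
  rewrite -RintegralZl// -RintegralD//; last exact: (@rintegrableZ _ _ _ mu).
  by apply: eq_Rintegral => y _; ring.
move=> /eqP; rewrite addr_eq0 => /eqP h1.
have := @le_normr_Rintegral _ _ _ mu _ _ mB ip; rewrite h1 normrN normrM mulrC leNgt => /negP; case.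
have rphi : r <= Rintegral mu (ball x r) phi.
  (* The plateau has length r, so r bounds the integral of phi from below. *)
  pose C := `[x - r / 2, x + r / 2]%classic.
  have CB : C `<=` ball x r.
    rewrite ball_itv => y; rewrite /C/= !in_itv/= => /andP[? ?].
    by apply/andP; split; lra.
  have C_r : Rintegral mu (ball x r) (\1_C) = r.
    rewrite /Rintegral (@integral_indic _ _ _ mu) //; last exact: measurable_itv.
    have muC : mu C = r%:E.
      by rewrite [LHS]lebesgue_measure_itv/= lte_fin ifT -?EFinB; [congr EFin|]; lra.
    transitivity (fine (mu C)); last by rewrite muC.
    by congr (fine (mu _)); exact: setIidl.
  have iC : mu.-integrable (ball x r) (EFin \o \1_C).
    apply: (@rintegrable_fun_bounded _ _ _ mu _ _ 1).
    - exact: mB.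
    - exact: Blt.
    - by apply: measurable_indic; exact: measurable_itv.
    - by move=> y; rewrite indicE; case: (_ \in _); rewrite ?normr0 ?normr1.
  rewrite -[leLHS]C_r; apply: (@le_Rintegral _ _ _ mu _ _ _ mB iC iphi) => y _.
  rewrite indicE; case: (boolP (_ \in _)) => [|_]; last by have /andP[] := phib y.
  by move=> /set_mem; rewrite /C/= in_itv/= => /phi1 ->.
have c2 : c / 4 * (r *+ 2) < r * c.
  have -> : c / 4 * (r *+ 2) = (r * c) / 2 by rewrite -mulr_natr; field.
  by rewrite ltr_pdivrMr// ltr_pMr ?mulr_gt0// ltr1n.
apply: (@lt_le_trans _ _ (r * c)); last first.
  rewrite ler_wpM2r ?normr_ge0// (le_trans rphi)// ler_norm//.
apply: le_lt_trans c2.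
apply: (@le_trans _ _ (Rintegral mu (ball x r) (fun y => `|h y - h x|))).
  apply: le_Rintegral => //; [exact: integrable_norm|exact: integrable_norm|].
  move=> y _; have /andP[p0 p1] := phib y.
  by rewrite normrM ler_piMl// ger0_norm.
move: dav; rewrite /davg /iavg [X in (X^-1 * _)%E]muB => dav.
set I := Rintegral _ _ _.
have IE : (\int[mu]_(y in ball x r) `|((center (h x) \o h) y)%:E|)%E = I%:E.
  rewrite /I /Rintegral fineK//.
  by apply: (@integrable_fin_num _ _ _ mu) => //; exact: (@integrable_norm _ _ _ mu).
have r2 : 0 < r *+ 2 by rewrite mulrn_wgt0.
move: dav; rewrite IE inver gt_eqF// -EFinM lte_fin mulrC ltr_pdivrMr//.
exact: ltW.
Unshelve. all: by end_near. Qed.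

End FundamentalLemma.

Section RealLebesgue.
Context {R : realType}.
Implicit Types (f g : R -> R).
Local Notation mu := (@lebesgue_measure R).

Lemma ae_impl (P Q : R -> Prop) : (forall x, P x -> Q x) ->
  {ae mu, forall x, P x} -> {ae mu, forall x, Q x}.
Proof. by move=> PQ P1; exact: (@filterS _ _ (ae_filter_ringOfSetsType mu) P Q PQ P1). Qed.

Lemma ae_and (P Q : R -> Prop) :
  {ae mu, forall x, P x} -> {ae mu, forall x, Q x} ->
  {ae mu, forall x, P x /\ Q x}.
Proof.
by move=> P1 Q1; exact: (@filterI _ _ (ae_filter_ringOfSetsType mu) P Q P1 Q1).
Qed.

Local Notation mu2 := (mu \x mu)%E.

(** The inner integral of an integrable function of two variables may be infinite
    on a null set, where [Rintegral] takes the value 0. *)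
Lemma fine_integrable (F : R -> \bar R) : mu.-integrable setT F ->
  mu.-integrable setT (EFin \o (fine \o F)) /\
  fine (\int[mu]_x F x)%E = Rintegral mu setT (fine \o F).
Proof.
move=> iF; have mF := measurable_int mu iF.
have mf : measurable_fun setT (EFin \o (fine \o F)).
  by apply/measurable_EFinP; exact: measurableT_comp.
have ae : {ae mu, forall x, setT x -> F x = (EFin \o (fine \o F)) x}.
  have := @integrable_ae _ _ _ mu _ measurableT _ iF.
  by apply: ae_impl => x /= Fx _; rewrite fineK// Fx.
split; last by rewrite /Rintegral; congr fine; exact: (@ae_eq_integral _ _ _ mu).
apply: (@le_integrable _ _ _ mu _ measurableT _ F) => //.
by move=> x _ /=; case: (F x) => [r| |] //=; rewrite normr0 leey.
Qed.

Lemma real_fubini (h : R * R -> R) : mu2.-integrable setT (EFin \o h) ->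
  [/\ mu.-integrable setT (EFin \o (fun x => Rintegral mu setT (fun y => h (x, y)))),
      mu.-integrable setT (EFin \o (fun y => Rintegral mu setT (fun x => h (x, y)))) &
   Rintegral mu setT (fun x => Rintegral mu setT (fun y => h (x, y))) =
   Rintegral mu setT (fun y => Rintegral mu setT (fun x => h (x, y)))].
Proof.
move=> ih; have [F1 F2] := fine_integrable (@integrable_fubini_F _ _ _ _ _ mu mu _ ih).
have iG : mu.-integrable setT (fubini_G mu (EFin \o h)).
  have mh : measurable_fun setT (EFin \o h) by case/integrableP: ih.
  have ih' : mu2.-integrable setT ((EFin \o h) \o (fun z => (z.2, z.1))).
    apply/integrable12ltyP.
      by apply: measurableT_comp => //; exact: measurable_swap.
    exact: ((integrable21ltyP mu mu mh).1 ih).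
  exact: (@integrable_fubini_F _ _ _ _ _ mu mu _ ih').
have [G1 G2] := fine_integrable iG; split; [exact: F1|exact: G1|].
rewrite -[LHS]F2 -[RHS]G2; congr fine; exact: (Fubini ih).
Qed.

Lemma measurable_shift (a : R) :
  @measurable_fun _ _ (measurableTypeR R) (measurableTypeR R) setT (fun x => x + a).
Proof. by apply: measurable_funD. Qed.

Lemma lebesgue_measure_shift (a : R) (A : set (measurableTypeR R)) : measurable A ->
  pushforward mu ((fun x => x + a) : measurableTypeR R -> measurableTypeR R) A = mu A.
Proof.
move=> mA; apply/esym/lebesgue_measure_unique => //=; first exact: measurable_shift.
move=> ms _ [[x y]] _ <-; rewrite /pushforward/=.
have -> : (fun z : R => z + a) @^-1` `]x, y] = `]x - a, y - a]%classic.
  by apply/seteqP; split=> z /=; rewrite !in_itv/= ltrBlDr lerBrDr.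
by rewrite !lebesgue_measure_itv/= !lte_fin ltrD2r; case: ifPn => // _; congr EFin; ring.
Qed.

Lemma Rintegral_shift (h : R -> R) (a : R) :
  mu.-integrable setT (EFin \o (fun x => h (x + a))) ->
  measurable_fun setT h ->
  Rintegral mu setT (fun x => h (x + a)) = Rintegral mu setT h.
Proof.
move=> ih mh.
have := @integral_pushforward _ _ _ _ R _ (measurable_shift a) mu setT (EFin \o h) _ ih measurableT.
rewrite preimage_setT => H; rewrite /Rintegral; congr fine.
rewrite -[LHS]H; last exact/measurable_EFinP.
apply: eq_measure_integral; first exact: measurable_shift.
move=> ms A mA _; exact: lebesgue_measure_shift.
Qed.

(** Allowing one exceptional c suits a kernel K(x - t), which may have a corner at
    the origin. *)
Lemma dominated_cvg_dnbhs (K : R -> R -> R) (K0 G : R -> R) (a c : R) :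
  (forall h, measurable_fun setT (K h)) -> measurable_fun setT K0 ->
  mu.-integrable setT (EFin \o G) ->
  (forall h t, h != a -> `|K h t| <= G t) ->
  (forall t, t != c -> K h t @[h --> a^'] --> K0 t) ->
  Rintegral mu setT (K h) @[h --> a^'] --> Rintegral mu setT K0.
Proof.
move=> mK mK0 iG KG KK0; apply/cvgr_dnbhsP => u [ua cua].
have mKE n : measurable_fun setT (EFin \o K (u n)).
  apply/measurable_EFinP.
  exact: mK.
have mK0E : measurable_fun setT (EFin \o K0) by exact/measurable_EFinP.
have [|||||iK0 _] := @dominated_convergence _ _ _ mu setT measurableT
  (fun n => EFin \o K (u n)) (EFin \o K0) (EFin \o G).
- exact: mKE.
- exact: mK0E.
- exists [set c]; split; [exact: measurable_set1|exact: lebesgue_measure_set1|].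
  move=> t /= nt; apply: contrapT => /eqP tc; apply: nt => _.
  by apply: cvg_EFin; [exact: nearW|move/cvgr_dnbhsP: (KK0 _ tc); exact].
- exact: iG.
- by apply: aeW => t n _; rewrite /= lee_fin KG.
move=> H; apply: fine_cvg; rewrite fineK//.
exact: (@integrable_fin_num _ _ _ mu).
Qed.

Lemma Rintegral_ae f g : measurable_fun setT f -> measurable_fun setT g ->
  {ae mu, forall x, f x = g x} -> Rintegral mu setT f = Rintegral mu setT g.
Proof.
move=> mf mg fg; rewrite /Rintegral; congr fine.
apply: (@ae_eq_integral _ _ _ mu) => //; [exact/measurable_EFinP|exact/measurable_EFinP|].
by apply: ae_impl fg => x /= -> _.
Qed.

Lemma FTC_itv (F f : R -> R) (a b : R) : a <= b -> (forall x : R, is_derive x 1 F (f x)) ->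
  continuous f -> Rintegral mu `[a, b] f = F b - F a.
Proof.
rewrite le_eqVlt => /predU1P[<-|ab] dF cf.
  by rewrite set_itv1 Rintegral_set1 subrr.
rewrite /Rintegral (@continuous_FTC2 _ f F)//.
- exact: continuous_subspaceT.
- have cF : continuous F.
    by move=> x; apply: differentiable_continuous; apply/derivable1_diffP; exact: derivable_is (dF x).
  split; first by move=> x _; exact: derivable_is (dF x).
    by apply: cvg_at_right_filter; exact: cF.
  by apply: cvg_at_left_filter; exact: cF.
- by move=> x _; exact: derive1_is.
Qed.

Lemma integrable_support (A : set (measurableTypeR R)) (h : R -> R) : measurable A ->
  (forall x, ~ A x -> h x = 0) ->
  mu.-integrable A (EFin \o h) -> mu.-integrable setT (EFin \o h).
Proof.
move=> mA h0 /(integrable_mkcond _ mA); congr integrable.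
apply/funext => x; rewrite patchE; case: ifPn => // /negP.
by rewrite inE => /h0 /= ->.
Qed.

(** Extended by F2 beyond c, F1 becomes a compactly supported antiderivative with
    one jump, so that the integral is the opposite of the jump. *)
Lemma broken_FTC (F1 F2 f1 f2 : R -> R) (c M : R) :
  (forall x : R, is_derive x 1 F1 (f1 x)) -> (forall x : R, is_derive x 1 F2 (f2 x)) ->
  continuous f1 -> continuous f2 ->
  (forall x, x <= - M -> F1 x = 0 /\ f1 x = 0) ->
  (forall x, M <= x -> F2 x = 0 /\ f2 x = 0) ->
  mu.-integrable setT (EFin \o (fun x => if x < c then f1 x else f2 x)) /\
  Rintegral mu setT (fun x => if x < c then f1 x else f2 x) = F1 c - F2 c.
Proof.
move=> dF1 dF2 cf1 cf2 F10 F20.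
pose a := Num.min (- M) c; pose b := Num.max M c.
have ac : a <= c by rewrite ge_min lexx orbT.
have cb : c <= b by rewrite le_max lexx orbT.
have h0 x : ~ `[a, b]%classic x -> (if x < c then f1 x else f2 x) = 0.
  rewrite /= in_itv/= => /negP; rewrite negb_and -!ltNge => /orP[|].
    by rewrite lt_min => /andP[/ltW/F10[_ ->] ->].
  by rewrite gt_max => /andP[/ltW/F20[_ ->] /ltW]; rewrite leNgt => /negbTE ->.
have ci f : continuous f -> mu.-integrable `[a, b] (EFin \o f).
  move=> cf; apply: continuous_compact_integrable; first exact: segment_compact.
  exact: continuous_subspaceT.
have icb : mu.-integrable `[a, b] (EFin \o (fun x => if x < c then f1 x else f2 x)).
  have -> : (fun x => if x < c then f1 x else f2 x) =
    (fun x => \1_(`]-oo, c[%classic) x * f1 x + \1_(`[c, +oo[%classic) x * f2 x).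
    apply/funext => x; rewrite !indicE !mem_setE !in_itv/= andbT leNgt.
    by case: ltP; rewrite /= ?mul1r ?mul0r ?addr0 ?add0r.
  have bnd (A : set R) x : `|\1_A x| <= 1 :> R.
    by rewrite indicE; case: (_ \in _); rewrite ?normr0 ?normr1.
  apply: (@rintegrableD _ _ _ mu); first exact: measurable_itv.
    apply: (@rintegrable_bounded _ _ _ mu _ _ _ 1) ; [exact: measurable_itv| |exact: bnd|exact: ci].
    by apply: measurable_indic; exact: measurable_itv.
  apply: (@rintegrable_bounded _ _ _ mu _ _ _ 1) ; [exact: measurable_itv| |exact: bnd|exact: ci].
  by apply: measurable_indic; exact: measurable_itv.
split; first by apply: integrable_support h0 icb; exact: measurable_itv.
rewrite (Rintegral_support h0).
have := @Rintegral_itvB _ _ (BLeft a) (BRight b) c icb ac cb.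
move/(canRL (subrK _)) => ->.
have -> : Rintegral mu `]c, b] (fun x => if x < c then f1 x else f2 x) = - F2 c.
  rewrite (@eq_Rintegral _ _ _ mu _ f2); last first.
    by move=> x; rewrite mem_setE in_itv/= => /andP[/ltW cx _]; rewrite ltNge cx.
  rewrite Rintegral_itv_obnd_cbnd; last first.
    apply: (@integrableS _ _ _ mu _ _ _ _ _ _ (ci _ cf2)); [exact: measurable_itv|exact: measurable_itv|].
    by move=> x /=; rewrite !in_itv/= => /andP[/ltW cx ->]; rewrite (le_trans ac cx).
  by rewrite (FTC_itv cb dF2 cf2) (F20 b _).1 ?sub0r// le_max lexx.
rewrite -Rintegral_itv_bndo_bndc; last first.
  apply: (@integrableS _ _ _ mu _ _ _ _ _ _ icb); [exact: measurable_itv|exact: measurable_itv|].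
  by move=> x /=; rewrite !in_itv/= => /andP[-> /ltW cx]; rewrite (le_trans cx cb).
rewrite (@eq_Rintegral _ _ _ mu _ f1); last first.
  by move=> x; rewrite mem_setE in_itv/= => /andP[_ ->].
rewrite Rintegral_itv_bndo_bndc; last first.
  apply: (@integrableS _ _ _ mu _ _ _ _ _ _ (ci _ cf1)); [exact: measurable_itv|exact: measurable_itv|].
  by move=> x /=; rewrite !in_itv/= => /andP[-> /ltW cx]; rewrite (le_trans cx cb).
by rewrite (FTC_itv ac dF1 cf1) (F10 a _).1 ?subr0 1?addrC// ge_min lexx.
Qed.

End RealLebesgue.

Local Notation Re := complex.Re.
Local Notation Im := complex.Im.

(** * Complex-valued functions *)

Section ComplexParts.
Context {R : realType}.
Implicit Types (x y z : R[i]).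

Lemma cRe0 : Re (0 : R[i]) = 0. Proof. by []. Qed.
Lemma cIm0 : Im (0 : R[i]) = 0. Proof. by []. Qed.
Lemma cReD x y : Re (x + y) = Re x + Re y. Proof. by case: x; case: y. Qed.
Lemma cImD x y : Im (x + y) = Im x + Im y. Proof. by case: x; case: y. Qed.
Lemma cReN x : Re (- x) = - Re x. Proof. by case: x. Qed.
Lemma cImN x : Im (- x) = - Im x. Proof. by case: x. Qed.
Lemma cReM x y : Re (x * y) = Re x * Re y - Im x * Im y.
Proof. by case: x; case: y. Qed.
Lemma cImM x y : Im (x * y) = Re x * Im y + Im x * Re y.
Proof. by case: x => a b; case: y => c d /=; ring. Qed.
Lemma cRer (r : R) : Re (r%:C) = r. Proof. by []. Qed.
Lemma cImr (r : R) : Im (r%:C) = 0. Proof. by []. Qed.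
Lemma complex_ext x y : Re x = Re y -> Im x = Im y -> x = y.
Proof. by case: x => a b; case: y => c d /= -> ->. Qed.

Definition cE := (cRe0, cIm0, cReD, cImD, cReN, cImN, cReM, cImM, cRer, cImr).

End ComplexParts.

Section ComplexIntegrable.
Context d (T : measurableType d) {R : realType} (mu : {measure set T -> \bar R}).
Implicit Types (D : set T) (h g K : T -> R[i]).

Definition cmeasurable D h :=
  measurable_fun D (fun t => Re (h t)) /\ measurable_fun D (fun t => Im (h t)).

Definition cbounded (C : R) K := forall t, `|Re (K t)| <= C /\ `|Im (K t)| <= C.

Lemma cmeasurableD D h g : cmeasurable D h -> cmeasurable D g ->
  cmeasurable D (fun t => h t + g t).
Proof.
move=> [h1 h2] [g1 g2]; split.
- by under eq_fun do rewrite cReD; exact: measurable_funD.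
- by under eq_fun do rewrite cImD; exact: measurable_funD.
Qed.

Lemma cmeasurableM D h g : cmeasurable D h -> cmeasurable D g ->
  cmeasurable D (fun t => h t * g t).
Proof.
move=> [h1 h2] [g1 g2]; split.
- under eq_fun do rewrite cReM.
  by apply: measurable_funB; exact: measurable_funM.
- under eq_fun do rewrite cImM.
  by apply: measurable_funD; exact: measurable_funM.
Qed.

Lemma cmeasurable_cst D (c : R[i]) : cmeasurable D (fun=> c).
Proof. by split; exact: measurable_cst. Qed.

Lemma cintegrable_measurable D h : cintegrable mu D h -> cmeasurable D h.
Proof.
by move=> [/measurable_int m1 /measurable_int m2]; split; apply/measurable_EFinP.
Qed.

Lemma cintegrableD D h g : measurable D -> cintegrable mu D h ->
  cintegrable mu D g -> cintegrable mu D (fun t => h t + g t).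
Proof.
move=> mD [h1 h2] [g1 g2]; split.
- by under eq_fun do rewrite cReD; exact: rintegrableD.
- by under eq_fun do rewrite cImD; exact: rintegrableD.
Qed.

Lemma cintegrableM D K h (C : R) : measurable D -> cmeasurable D K -> cbounded C K ->
  cintegrable mu D h -> cintegrable mu D (fun t => K t * h t).
Proof.
move=> mD [k1 k2] KC [h1 h2]; split.
- under eq_fun do rewrite cReM.
  apply: rintegrableB => //; apply: (rintegrable_bounded (C := C)) => // t.
    by have [] := KC t.
  by have [] := KC t.
- under eq_fun do rewrite cImM.
  apply: rintegrableD => //; apply: (rintegrable_bounded (C := C)) => // t.
    by have [] := KC t.
  by have [] := KC t.
Qed.

Lemma cbounded_cst (c : R[i]) : cbounded (`|Re c| + `|Im c|) (fun=> c).
Proof. by move=> t; rewrite lerDl lerDr !normr_ge0. Qed.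

Lemma cintegrableZ D h (c : R[i]) : measurable D -> cintegrable mu D h ->
  cintegrable mu D (fun t => c * h t).
Proof.
by move=> mD; apply: (cintegrableM mD (cmeasurable_cst D c) (cbounded_cst c)).
Qed.

Lemma cintegrable0 D : cintegrable mu D (fun=> 0).
Proof. by split; exact: integrable0. Qed.

Lemma cboundedM K h (C C' : R) : cbounded C K -> cbounded C' h ->
  cbounded (2 * (C * C')) (fun t => K t * h t).
Proof.
move=> KC hC t; have [a b] := KC t; have [a' b'] := hC t.
have le u v : `|u| <= C -> `|v| <= C' -> `|u * v| <= C * C'.
  by move=> *; rewrite normrM ler_pM.
rewrite cReM cImM mulr_natl mulr2n; split.
  by apply: le_trans (ler_normB _ _) _; rewrite lerD ?le.
by apply: le_trans (ler_normD _ _) _; rewrite lerD ?le.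
Qed.

End ComplexIntegrable.

Section ComplexIntegral.
Context {R : realType}.
Implicit Types (h g F psi : R -> R[i]) (D : set R).
Local Notation mu := (@lebesgue_measure R).
Local Notation mu2 := (mu \x mu)%E.

Lemma eq_cint D h g : (forall x, D x -> h x = g x) -> cint D h = cint D g.
Proof.
move=> hg; congr (_ +i* _); apply: eq_Rintegral => x xD; rewrite hg//;
  exact: set_mem.
Qed.

Lemma cint_support D h : (forall x, ~ D x -> h x = 0) -> cint setT h = cint D h.
Proof.
move=> h0; congr (_ +i* _); apply: Rintegral_support => x Dx; by rewrite h0.
Qed.

Lemma cintD h g : cintegrable mu setT h -> cintegrable mu setT g ->
  cint setT (fun x => h x + g x) = cint setT h + cint setT g.
Proof.
move=> [h1 h2] [g1 g2]; apply: complex_ext; rewrite cE.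
- transitivity (Rintegral mu setT (fun x => Re (h x) + Re (g x))).
    by apply: eq_Rintegral => x _; rewrite cReD.
  exact: (@RintegralD _ _ _ mu).
- transitivity (Rintegral mu setT (fun x => Im (h x) + Im (g x))).
    by apply: eq_Rintegral => x _; rewrite cImD.
  exact: (@RintegralD _ _ _ mu).
Qed.

Lemma cintZ h (c : R[i]) : cintegrable mu setT h ->
  cint setT (fun x => c * h x) = c * cint setT h.
Proof.
move=> [h1 h2]; apply: complex_ext.
- rewrite [RHS]cReM; transitivity (Rintegral mu setT (fun x => Re c * Re (h x) - Im c * Im (h x))).
    by apply: eq_Rintegral => x _; rewrite cReM.
  rewrite (@RintegralB _ _ _ mu) ?(@RintegralZl _ _ _ mu)//; exact: (@rintegrableZ _ _ _ mu).
- rewrite [RHS]cImM; transitivity (Rintegral mu setT (fun x => Re c * Im (h x) + Im c * Re (h x))).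
    by apply: eq_Rintegral => x _; rewrite cImM.
  rewrite (@RintegralD _ _ _ mu) ?(@RintegralZl _ _ _ mu)//; exact: (@rintegrableZ _ _ _ mu).
Qed.

Lemma cint_ae h g : cmeasurable setT h -> cmeasurable setT g ->
  {ae mu, forall x, h x = g x} -> cint setT h = cint setT g.
Proof.
move=> [h1 h2] [g1 g2] hg; congr (_ +i* _); apply: Rintegral_ae => //.
- by apply: ae_impl hg => x ->.
- by apply: ae_impl hg => x ->.
Qed.

Lemma cint0 D : cint D (fun=> 0 : R[i]) = 0.
Proof. by congr (_ +i* _); rewrite /Rintegral integral0. Qed.

Lemma cintegrable_support (A : set (measurableTypeR R)) h : measurable A ->
  (forall x, ~ A x -> h x = 0) ->
  cintegrable mu A h -> cintegrable mu setT h.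
Proof.
by move=> mA h0 [h1 h2]; split; apply: (integrable_support mA) => // x /h0 ->.
Qed.

Lemma cint_shift h (a : R) : cintegrable mu setT (fun x => h (x + a)) ->
  cmeasurable setT h -> cint setT (fun x => h (x + a)) = cint setT h.
Proof.
move=> [i1 i2] [m1 m2]; congr (_ +i* _).
  exact: (Rintegral_shift (h := fun x => Re (h x))).
exact: (Rintegral_shift (h := fun x => Im (h x))).
Qed.

Lemma product_integrable (f g : R -> R) :
  mu.-integrable setT (EFin \o f) -> mu.-integrable setT (EFin \o g) ->
  mu2.-integrable setT (EFin \o (fun z => f z.1 * g z.2)).
Proof.
move=> fi gi.
have mf : measurable_fun setT f by apply/measurable_EFinP; case/integrableP: fi.
have mg : measurable_fun setT g by apply/measurable_EFinP; case/integrableP: gi.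
have mh : measurable_fun setT (EFin \o (fun z : R * R => f z.1 * g z.2)).
  apply/measurable_EFinP; apply: measurable_funM.
    by apply: measurableT_comp => //; exact: measurable_fst.
  by apply: measurableT_comp => //; exact: measurable_snd.
apply/integrable12ltyP => //.
have I1 : (\int[mu]_y `|g y|%:E < +oo)%E by case/integrableP: gi.
have I2 : (\int[mu]_y `|f y|%:E < +oo)%E by case/integrableP: fi.
rewrite (@eq_integral _ _ _ mu _ (fun x => (`|f x|%:E * \int[mu]_y `|g y|%:E)%E)); last first.
  move=> x _; rewrite -(@ge0_integralZl_EFin _ _ _ mu)//.
  - by apply: eq_integral => y _ /=; rewrite normrM EFinM.
  - by apply/measurable_EFinP; exact: measurableT_comp.
have G0 : (0 <= \int[mu]_y `|g y|%:E)%E by apply: integral_ge0 => y _; rewrite lee_fin.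
have fG : (\int[mu]_y `|g y|%:E)%E \is a fin_num by rewrite ge0_fin_numE.
rewrite -(fineK fG).
under eq_integral do rewrite muleC.
rewrite (@ge0_integralZl_EFin _ _ _ mu)//; last 2 first.
- by apply/measurable_EFinP; exact: measurableT_comp.
- by rewrite fine_ge0.
by rewrite lte_mul_pinfty// lee_fin fine_ge0.
Qed.

Lemma cproduct_integrable psi F : cintegrable mu setT psi -> cintegrable mu setT F ->
  cintegrable mu2 setT (fun z => psi z.1 * F z.2).
Proof.
move=> [p1 p2] [f1 f2]; split.
- under eq_fun do rewrite cReM.
  apply: (@rintegrableB _ _ _ mu2) => //.
    exact: (product_integrable p1 f1).
  exact: (product_integrable p2 f2).
- under eq_fun do rewrite cImM.
  apply: (@rintegrableD _ _ _ mu2) => //.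
    exact: (product_integrable p1 f2).
  exact: (product_integrable p2 f1).
Qed.

Lemma cfubini (h : R * R -> R[i]) : cintegrable mu2 setT h ->
  [/\ cintegrable mu setT (fun x => cint setT (fun y => h (x, y))),
      cintegrable mu setT (fun y => cint setT (fun x => h (x, y))) &
      cint setT (fun x => cint setT (fun y => h (x, y))) =
      cint setT (fun y => cint setT (fun x => h (x, y)))].
Proof.
move=> [/real_fubini[a1 b1 c1] /real_fubini[a2 b2 c2]].
split; [split; [exact: a1|exact: a2]|split; [exact: b1|exact: b2]|].
by apply: complex_ext; [exact: c1|exact: c2].
Qed.

Lemma cmeasurable_pair1 (K : R * R -> R[i]) (x : R) : cmeasurable setT K ->
  cmeasurable setT (fun y => K (x, y)).
Proof.
move=> [k1 k2]; split.
  apply: (measurableT_comp (f := fun z => Re (K z)) k1); exact: pair1_measurable.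
apply: (measurableT_comp (f := fun z => Im (K z)) k2); exact: pair1_measurable.
Qed.

Lemma cmeasurable_pair2 (K : R * R -> R[i]) (y : R) : cmeasurable setT K ->
  cmeasurable setT (fun x => K (x, y)).
Proof.
move=> [k1 k2]; split.
  apply: (measurableT_comp (f := fun z => Re (K z)) k1); exact: pair2_measurable.
apply: (measurableT_comp (f := fun z => Im (K z)) k2); exact: pair2_measurable.
Qed.

(** The common source of the two exchanges of integrals below: the potential of F
    tested against phi, with K(x, t) = G(x - t), and the convolution of G with F,
    with K(x, t) = phi(x + t). *)
Lemma cfubini_kernel (K : R * R -> R[i]) (C : R) psi F :
  cmeasurable setT K -> cbounded C K ->
  cintegrable mu setT psi -> cintegrable mu setT F ->
  [/\ cintegrable mu setT (fun x => psi x * cint setT (fun t => K (x, t) * F t)),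
      cintegrable mu setT (fun t => F t * cint setT (fun x => K (x, t) * psi x)) &
  cint setT (fun x => psi x * cint setT (fun t => K (x, t) * F t)) =
  cint setT (fun t => F t * cint setT (fun x => K (x, t) * psi x))].
Proof.
move=> mK KC ip iF.
have := @cintegrableM _ _ _ mu2 _ _ _ C measurableT mK KC (cproduct_integrable ip iF).
move/cfubini => [].
have -> : (fun x => cint setT (fun y => K (x, y) * (psi (x, y).1 * F (x, y).2))) =
    (fun x => psi x * cint setT (fun t => K (x, t) * F t)).
  apply/funext => x; rewrite -cintZ.
    by apply: eq_cint => y _ /=; rewrite mulrCA.
  apply: (@cintegrableM _ _ _ mu _ _ _ C) => //; exact: cmeasurable_pair1.
have -> : (fun y => cint setT (fun x => K (x, y) * (psi (x, y).1 * F (x, y).2))) =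
    (fun t => F t * cint setT (fun x => K (x, t) * psi x)).
  apply/funext => y; rewrite -cintZ.
    by apply: eq_cint => x _ /=; rewrite mulrA mulrC.
  apply: (@cintegrableM _ _ _ mu _ _ _ C) => //; exact: cmeasurable_pair2.
by [].
Qed.

End ComplexIntegral.

(** * Convolution with a bounded kernel *)

Section RealConvolution.
Context {R : realType}.
Implicit Types (k dk F : R -> R).
Local Notation mu := (@lebesgue_measure R).

Lemma rconv_integrable k F (M x : R) : measurable_fun setT k -> (forall s, `|k s| <= M) ->
  mu.-integrable setT (EFin \o F) ->
  mu.-integrable setT (EFin \o (fun t => k (x - t) * F t)).
Proof.
move=> mk kM iF; apply: (@rintegrable_bounded _ _ _ mu _ _ _ M) => //.
by apply: (measurableT_comp mk); exact: measurable_funB.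
Qed.

(** The kernel may have a corner at the origin: the difference quotients in x of
    k(x - t) converge for t <> x, and the Lipschitz bound dominates them. *)
Lemma rconv_derive k dk F (M x : R) : measurable_fun setT k -> measurable_fun setT dk ->
  (forall s, `|k s| <= M) -> (forall s u, `|k s - k u| <= M * `|s - u|) ->
  (forall s : R, s != 0 -> is_derive s 1 k (dk s)) ->
  mu.-integrable setT (EFin \o F) ->
  is_derive x 1 (fun x => Rintegral mu setT (fun t => k (x - t) * F t))
    (Rintegral mu setT (fun t => dk (x - t) * F t)).
Proof.
move=> mk mdk kM kL dkk iF; set V := (fun x => _); set W := Rintegral _ _ _.
have mF : measurable_fun setT F by apply/measurable_EFinP; case/integrableP: iF.
have msub (g : R -> R) (y : R) : measurable_fun setT g -> measurable_fun setT (fun t : R => g (y - t)).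
  by move=> mg; apply: (measurableT_comp mg); exact: measurable_funB.
suff lim0 : h^-1 *: (V (h *: 1 + x) - V x) @[h --> 0^'] --> W.
  apply/is_derive1P; split; first by apply/cvg_ex; exists W.
  by rewrite derive1E; apply/cvg_lim.
have -> : (fun h => h^-1 *: (V (h *: 1 + x) - V x)) =
    (fun h => Rintegral mu setT (fun t => h^-1 * (k (h + x - t) - k (x - t)) * F t)).
  apply/funext => h; rewrite /V /GRing.scale/= mulr1.
  rewrite -(@RintegralB _ _ _ mu)//; [|exact: rconv_integrable kM iF|exact: rconv_integrable kM iF].
  rewrite -(@RintegralZl _ _ _ mu)//; last first.
    by apply: (@rintegrableB _ _ _ mu) => //; exact: rconv_integrable kM iF.
  by apply: eq_Rintegral => t _; rewrite -mulrBl mulrA.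
apply: (@dominated_cvg_dnbhs _ _ _ (fun t => M * `|F t|) _ x).
- move=> h; apply: measurable_funM => //; apply: measurable_funM => //.
  by apply: measurable_funB; exact: msub.
- by apply: measurable_funM => //; exact: msub.
- apply: (@rintegrableZ _ _ _ mu) => //; exact: (@integrable_norm _ _ _ mu).
- move=> h t h0; rewrite !normrM ler_wpM2r// normfV ler_pdivrMl ?normr_gt0// mulrC.
  by apply: le_trans (kL _ _) _; rewrite opprB addrA subrK addrK.
- move=> t tx; apply: cvgM; last exact: cvg_cst.
  have xt0 : x - t != 0 by rewrite subr_eq0 eq_sym.
  have [+ dkE] := (is_derive1P _ _ _).1 (dkk _ xt0).
  move=> /cvg_ex[l kl]; have <- : l = dk (x - t).
    by rewrite -dkE derive1E; apply/esym/cvg_lim.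
  apply: cvg_trans kl; apply: near_eq_cvg; near=> h.
  by rewrite /= /GRing.scale/= mulr1 addrA.
Unshelve. all: by end_near. Qed.

Lemma cvg_dnbhs_continuous (f : R -> R) (x : R) :
  f y @[y --> x^'] --> f x -> {for x, continuous f}.
Proof.
move=> fx; apply/cvgrPdist_lt => e e0.
have /cvgrPdist_lt/(_ _ e0) := fx; rewrite near_withinE.
apply: filterS => y; have [->|yx] := eqVneq y x; last by apply.
by rewrite subrr normr0.
Qed.

Lemma rconv_continuous k F (M : R) : measurable_fun setT k -> (forall s, `|k s| <= M) ->
  (forall s, s != 0 -> {for s, continuous k}) -> mu.-integrable setT (EFin \o F) ->
  continuous (fun x => Rintegral mu setT (fun t => k (x - t) * F t)).
Proof.
move=> mk kM ck iF x; apply: cvg_dnbhs_continuous.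
have mF : measurable_fun setT F by apply/measurable_EFinP; case/integrableP: iF.
have msub (g : R -> R) (y : R) : measurable_fun setT g -> measurable_fun setT (fun t : R => g (y - t)).
  by move=> mg; apply: (measurableT_comp mg); exact: measurable_funB.
apply: (@dominated_cvg_dnbhs _ (fun x t => k (x - t) * F t) _ (fun t => M * `|F t|) _ x).
- by move=> h; apply: measurable_funM => //; exact: msub.
- by apply: measurable_funM => //; exact: msub.
- apply: (@rintegrableZ _ _ _ mu) => //; exact: (@integrable_norm _ _ _ mu).
- by move=> h t _; rewrite normrM ler_wpM2r.
- move=> t tx; apply: cvgM; last exact: cvg_cst.
  have xt0 : x - t != 0 by rewrite subr_eq0 eq_sym.
  apply: (@cvg_comp _ _ _ (fun y => y - t) k _ (nbhs (x - t))); last exact: ck.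
  by apply: cvgB; [exact: cvg_within|exact: cvg_cst].
Qed.

End RealConvolution.

(** * Complex derivatives and exponentials *)

Section ComplexDerivative.
Context {R : realType}.
Implicit Types (h g : R -> R[i]) (x : R) (z l : R[i]).
Local Notation mu := (@lebesgue_measure R).

Definition is_cderive h x z :=
  is_derive x 1 (fun t => Re (h t)) (Re z) /\ is_derive x 1 (fun t => Im (h t)) (Im z).

Definition ccontinuous h :=
  continuous (fun t => Re (h t)) /\ continuous (fun t => Im (h t)).

Lemma is_cderiveP h x z : is_cderive h x z <-> cderivable h x /\ cderive h x = z.
Proof.
split.
  move=> [/is_derive1P[d1 e1] /is_derive1P[d2 e2]]; split => //.
  by rewrite /cderive e1 e2; apply: complex_ext.
by move=> [[d1 d2] <-]; split; apply/is_derive1P.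
Qed.

Lemma is_cderive_near h g x z : (\near x, h x = g x) ->
  is_cderive g x z -> is_cderive h x z.
Proof.
move=> hg [d1 d2]; split.
- by apply: is_derive_near d1; apply: filterS hg => y ->.
- by apply: is_derive_near d2; apply: filterS hg => y ->.
Qed.

Lemma is_cderive_cst (c : R[i]) x : is_cderive (fun=> c) x 0.
Proof. by split; exact: is_derive_cst. Qed.

Lemma is_cderiveD h g x z l : is_cderive h x z -> is_cderive g x l ->
  is_cderive (fun t => h t + g t) x (z + l).
Proof.
move=> [h1 h2] [g1 g2]; split; rewrite cE.
- by under eq_fun do rewrite cReD; exact: is_deriveD.
- by under eq_fun do rewrite cImD; exact: is_deriveD.
Qed.

Lemma is_cderiveM h g x z l : is_cderive h x z -> is_cderive g x l ->
  is_cderive (fun t => h t * g t) x (z * g x + h x * l).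
Proof.
move=> [h1 h2] [g1 g2]; split; rewrite cE.
- under eq_fun do rewrite cReM.
  have := is_deriveB (is_deriveM h1 g1) (is_deriveM h2 g2).
  by move/is_derive_eq; apply; rewrite !cE /GRing.scale/=; ring.
- under eq_fun do rewrite cImM.
  have := is_deriveD (is_deriveM h1 g2) (is_deriveM h2 g1).
  by move/is_derive_eq; apply; rewrite !cE /GRing.scale/=; ring.
Qed.

Lemma is_cderiveZ (c : R[i]) h x z : is_cderive h x z ->
  is_cderive (fun t => c * h t) x (c * z).
Proof.
by move=> hz; have := is_cderiveM (is_cderive_cst c x) hz; rewrite mul0r add0r.
Qed.

Lemma is_cderive_real (phi : R -> R) x d : is_derive x 1 phi d ->
  is_cderive (fun t => (phi t)%:C) x d%:C.
Proof. by move=> dp; split => //; exact: is_derive_cst. Qed.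

Lemma is_cderive_shift h (a : R) x z : is_cderive h (x - a) z ->
  is_cderive (fun t => h (t - a)) x z.
Proof.
have ds : is_derive x 1 (fun t => t - a) 1.
  have := is_deriveB (is_derive_id x 1) (is_derive_cst a x 1).
  by move/is_derive_eq; apply; rewrite subr0.
move=> [h1 h2]; split.
- by have := @is_derive1_comp _ (fun t => Re (h t)) (fun t => t - a) _ _ _ h1 ds; rewrite mulr1.
- by have := @is_derive1_comp _ (fun t => Im (h t)) (fun t => t - a) _ _ _ h2 ds; rewrite mulr1.
Qed.

Lemma derive_continuous (f df : R -> R) : (forall x : R, is_derive x 1 f (df x)) -> continuous f.
Proof.
move=> dF x; apply: differentiable_continuous; apply/derivable1_diffP.
exact: derivable_is (dF x).
Qed.

Lemma cderive_continuous h (dh : R -> R[i]) : (forall x, is_cderive h x (dh x)) ->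
  ccontinuous h.
Proof.
move=> dhh; split.
- by apply: (@derive_continuous _ (fun x => Re (dh x))) => x; have [] := dhh x.
- by apply: (@derive_continuous _ (fun x => Im (dh x))) => x; have [] := dhh x.
Qed.

Lemma ccontinuous_measurable h : ccontinuous h -> cmeasurable setT h.
Proof. by move=> [c1 c2]; split; exact: continuous_measurable_fun. Qed.

Definition wave l x : R[i] := cexp (l * x%:C).

Lemma waveE l x : wave l x = (expR (Re l * x) * cos (Im l * x)) +i*
  (expR (Re l * x) * sin (Im l * x)).
Proof.
by rewrite /wave /cexp cReM cImM /= !mulr0 subr0 add0r.
Qed.

Lemma wave0 l : wave l 0 = 1.
Proof. by rewrite waveE !mulr0 expR0 cos0 sin0 mul1r mulr0. Qed.

Lemma waveD l x y : wave l (x + y) = wave l x * wave l y.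
Proof.
by rewrite !waveE !mulrDr expRD cosD sinD; apply: complex_ext => /=; ring.
Qed.

Lemma waveN l x : wave (- l) x = wave l (- x).
Proof. by rewrite !waveE cReN cImN !mulNr !mulrN. Qed.

Lemma is_cderive_wave l x : is_cderive (wave l) x (l * wave l x).
Proof.
have dl (c : R) : is_derive x 1 (fun t => c * t) c.
  have := is_deriveZ c (is_derive_id x 1).
  by move/is_derive_eq; apply; rewrite /GRing.scale/= mulr1.
have de := @is_derive1_comp _ expR _ _ _ _ (is_derive_expR _) (dl (Re l)).
have dc := @is_derive1_comp _ cos _ _ _ _ (is_derive_cos _) (dl (Im l)).
have ds := @is_derive1_comp _ sin _ _ _ _ (is_derive_sin _) (dl (Im l)).
split.
- under eq_fun do rewrite waveE /=.
  have := is_deriveM de dc; move/is_derive_eq; apply.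
  by rewrite waveE; case: (l) => a b; rewrite /GRing.scale/=; ring.
- under eq_fun do rewrite waveE /=.
  have := is_deriveM de ds; move/is_derive_eq; apply.
  by rewrite waveE; case: (l) => a b; rewrite /GRing.scale/=; ring.
Qed.

Lemma cbroken_FTC (F1 F2 f1 f2 : R -> R[i]) (c M : R) :
  (forall x, is_cderive F1 x (f1 x)) -> (forall x, is_cderive F2 x (f2 x)) ->
  ccontinuous f1 -> ccontinuous f2 ->
  (forall x, x <= - M -> F1 x = 0 /\ f1 x = 0) ->
  (forall x, M <= x -> F2 x = 0 /\ f2 x = 0) ->
  cintegrable mu setT (fun x => if x < c then f1 x else f2 x) /\
  cint setT (fun x => if x < c then f1 x else f2 x) = F1 c - F2 c.
Proof.
move=> dF1 dF2 [cf1 cf1'] [cf2 cf2'] F10 F20.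
have [i1 e1] := @broken_FTC R _ _ _ _ c M (fun x => (dF1 x).1) (fun x => (dF2 x).1) cf1 cf2
  (fun x hx => conj (congr1 (@Re R) (F10 x hx).1) (congr1 (@Re R) (F10 x hx).2))
  (fun x hx => conj (congr1 (@Re R) (F20 x hx).1) (congr1 (@Re R) (F20 x hx).2)).
have [i2 e2] := @broken_FTC R _ _ _ _ c M (fun x => (dF1 x).2) (fun x => (dF2 x).2) cf1' cf2'
  (fun x hx => conj (congr1 (@Im R) (F10 x hx).1) (congr1 (@Im R) (F10 x hx).2))
  (fun x hx => conj (congr1 (@Im R) (F20 x hx).1) (congr1 (@Im R) (F20 x hx).2)).
split; first split.
- by under eq_fun do rewrite (fun_if (@Re R)); exact: i1.
- by under eq_fun do rewrite (fun_if (@Im R)); exact: i2.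
apply: complex_ext; rewrite /= !cE.
- by rewrite -e1; apply: eq_Rintegral => x _; rewrite (fun_if (@Re R)).
- by rewrite -e2; apply: eq_Rintegral => x _; rewrite (fun_if (@Im R)).
Qed.

End ComplexDerivative.

Section Kernel.
Context {R : realType}.
Implicit Types (F : R -> R[i]) (x s t : R).
Local Notation mu := (@lebesgue_measure R).

Lemma cmeasurable_sub (K : R -> R[i]) x : cmeasurable setT K ->
  cmeasurable setT (fun t => K (x - t)).
Proof.
move=> [k1 k2]; split.
- by apply: (measurableT_comp (f := fun z => Re (K z)) k1); exact: measurable_funB.
- by apply: (measurableT_comp (f := fun z => Im (K z)) k2); exact: measurable_funB.
Qed.

Lemma cconv_integrable (K : R -> R[i]) (M : R) F x :
  cmeasurable setT K -> cbounded M K -> cintegrable mu setT F ->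
  cintegrable mu setT (fun t => K (x - t) * F t).
Proof.
move=> mK KM iF; apply: (@cintegrableM _ _ _ mu _ _ _ M) => //.
exact: cmeasurable_sub.
Qed.

Lemma cconvE (K : R -> R[i]) (M : R) F x :
  cmeasurable setT K -> cbounded M K -> cintegrable mu setT F ->
  Re (cint setT (fun t => K (x - t) * F t)) =
    Rintegral mu setT (fun t => Re (K (x - t)) * Re (F t)) -
    Rintegral mu setT (fun t => Im (K (x - t)) * Im (F t)) /\
  Im (cint setT (fun t => K (x - t) * F t)) =
    Rintegral mu setT (fun t => Re (K (x - t)) * Im (F t)) +
    Rintegral mu setT (fun t => Im (K (x - t)) * Re (F t)).
Proof.
move=> [k1 k2] KM [F1 F2].
have b1 s : `|Re (K s)| <= M by have [] := KM s.
have b2 s : `|Im (K s)| <= M by have [] := KM s.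
split.
- rewrite -(@RintegralB _ _ _ mu)//.
  + by apply: eq_Rintegral => t _; rewrite cReM.
  + exact: (@rconv_integrable _ (fun s => Re (K s)) _ M).
  + exact: (@rconv_integrable _ (fun s => Im (K s)) _ M).
- rewrite -(@RintegralD _ _ _ mu)//.
  + by apply: eq_Rintegral => t _; rewrite cImM.
  + exact: (@rconv_integrable _ (fun s => Re (K s)) _ M).
  + exact: (@rconv_integrable _ (fun s => Im (K s)) _ M).
Qed.

Lemma cconv_derive (K dK : R -> R[i]) (M : R) F x :
  cmeasurable setT K -> cmeasurable setT dK -> cbounded M K -> cbounded M dK ->
  (forall s u, `|Re (K s) - Re (K u)| <= M * `|s - u|) ->
  (forall s u, `|Im (K s) - Im (K u)| <= M * `|s - u|) ->
  (forall s, s != 0 -> is_cderive K s (dK s)) ->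
  cintegrable mu setT F ->
  is_cderive (fun x => cint setT (fun t => K (x - t) * F t)) x
    (cint setT (fun t => dK (x - t) * F t)).
Proof.
move=> mK mdK bK bdK L1 L2 dKK iF.
have [k1 k2] := mK; have [dk1 dk2] := mdK; have [F1 F2] := iF.
have b1 s : `|Re (K s)| <= M by have [] := bK s.
have b2 s : `|Im (K s)| <= M by have [] := bK s.
have d1 (s : R) : s != 0 -> is_derive s 1 (fun s => Re (K s)) (Re (dK s)) by move=> /dKK[].
have d2 (s : R) : s != 0 -> is_derive s 1 (fun s => Im (K s)) (Im (dK s)) by move=> /dKK[].
have [E1 E2] := cconvE x mdK bdK iF.
split.
- rewrite E1.
  have -> : (fun x => Re (cint setT (fun t => K (x - t) * F t))) = (fun x =>
    Rintegral mu setT (fun t => Re (K (x - t)) * Re (F t)) -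
    Rintegral mu setT (fun t => Im (K (x - t)) * Im (F t))).
    by apply/funext => y; rewrite (cconvE y mK bK iF).1.
  by apply: is_deriveB; apply: rconv_derive => //; eassumption.
- rewrite E2.
  have -> : (fun x => Im (cint setT (fun t => K (x - t) * F t))) = (fun x =>
    Rintegral mu setT (fun t => Re (K (x - t)) * Im (F t)) +
    Rintegral mu setT (fun t => Im (K (x - t)) * Re (F t))).
    by apply/funext => y; rewrite (cconvE y mK bK iF).2.
  by apply: is_deriveD; apply: rconv_derive => //; eassumption.
Qed.

Lemma cconv_continuous (K : R -> R[i]) (M : R) F :
  cmeasurable setT K -> cbounded M K ->
  (forall s : R, s != 0 -> {for s, continuous (fun s => Re (K s))}) ->
  (forall s : R, s != 0 -> {for s, continuous (fun s => Im (K s))}) ->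
  cintegrable mu setT F ->
  ccontinuous (fun x => cint setT (fun t => K (x - t) * F t)).
Proof.
move=> mK bK c1 c2 iF; have [k1 k2] := mK; have [F1 F2] := iF.
have b1 s : `|Re (K s)| <= M by have [] := bK s.
have b2 s : `|Im (K s)| <= M by have [] := bK s.
split.
- have -> : (fun x => Re (cint setT (fun t => K (x - t) * F t))) = (fun x =>
    Rintegral mu setT (fun t => Re (K (x - t)) * Re (F t)) -
    Rintegral mu setT (fun t => Im (K (x - t)) * Im (F t))).
    by apply/funext => y; rewrite (cconvE y mK bK iF).1.
  by move=> x; apply: cvgB; [exact: (rconv_continuous k1 b1 c1 F1)|exact: (rconv_continuous k2 b2 c2 F2)].
- have -> : (fun x => Im (cint setT (fun t => K (x - t) * F t))) = (fun x =>
    Rintegral mu setT (fun t => Re (K (x - t)) * Im (F t)) +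
    Rintegral mu setT (fun t => Im (K (x - t)) * Re (F t))).
    by apply/funext => y; rewrite (cconvE y mK bK iF).2.
  by move=> x; apply: cvgD; [exact: (rconv_continuous k1 b1 c1 F2)|exact: (rconv_continuous k2 b2 c2 F1)].
Qed.

End Kernel.

(** * The outgoing kernel and its potentials *)

Section Outgoing.
Context {R : realType}.
Variable (l : R[i]).
Hypotheses (l0 : l != 0) (Rel : Re l <= 0).
Implicit Types (F : R -> R[i]) (x s t : R).
Local Notation mu := (@lebesgue_measure R).

(** The Green function of a mode, for an arbitrary complex constant l in place of
    lambda. *)
Definition outgoing s : R[i] := - 1 / (2 * l) * wave l `|s|.

Definition doutgoing s : R[i] := (if s < 0 then - l else l) * outgoing s.

Let c0 : R[i] := - 1 / (2 * l).

Lemma outgoing_pos s : 0 <= s -> outgoing s = c0 * wave l s.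
Proof. by move=> s0; rewrite /outgoing ger0_norm. Qed.

Lemma outgoing_neg s : s <= 0 -> outgoing s = c0 * wave (- l) s.
Proof. by move=> s0; rewrite /outgoing ler0_norm// waveN. Qed.

Lemma wave_bounded s : 0 <= s -> `|Re (wave l s)| <= 1 /\ `|Im (wave l s)| <= 1.
Proof.
move=> s0; have e1 : expR (Re l * s) <= 1 by rewrite -expR0 ler_expR mulr_le0_ge0.
rewrite waveE /= !normrM (ger0_norm (expR_ge0 _)); split.
  by rewrite mulr_ile1 ?expR_ge0// ler_norml cos_geN1 cos_le1.
by rewrite mulr_ile1 ?expR_ge0// ler_norml sin_geN1 sin_le1.
Qed.

Let A : R := 2 * ((`|Re c0| + `|Im c0|) * 1).
Let A0 : 0 <= A. Proof. by rewrite /A mulr1 mulr_ge0// addr_ge0. Qed.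

Lemma outgoing_bounded0 : cbounded A outgoing.
Proof.
apply: (cboundedM (T := R)); first exact: cbounded_cst.
by move=> s; exact: wave_bounded.
Qed.

Let M : R := A + 2 * ((`|Re l| + `|Im l|) * A).

Lemma cbounded_le (C C' : R) (K : R -> R[i]) : C <= C' -> cbounded C K -> cbounded C' K.
Proof. by move=> CC KC t; have [a b] := KC t; rewrite !(le_trans _ CC). Qed.

Lemma outgoing_bounded : cbounded M outgoing.
Proof.
by apply: cbounded_le outgoing_bounded0; rewrite lerDl !mulr_ge0// addr_ge0.
Qed.

Lemma doutgoing_bounded : cbounded M doutgoing.
Proof.
apply: (@cbounded_le (2 * ((`|Re l| + `|Im l|) * A))); first by rewrite lerDr.
apply: (cboundedM (T := R)); last exact: outgoing_bounded0.
move=> s; case: ifPn => _; first rewrite cReN cImN !normrN;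
  by split; rewrite ?lerDl ?lerDr.
Qed.

Lemma outgoing_derive s : s != 0 -> is_cderive outgoing s (doutgoing s).
Proof.
rewrite neq_lt => /orP[s0|s0]; rewrite /doutgoing.
- rewrite s0; apply: (@is_cderive_near _ _ (fun s => c0 * wave (- l) s)).
    by near=> y; apply: outgoing_neg; apply: ltW; near: y; exact: lt_nbhsl.
  rewrite outgoing_neg ?ltW// mulrCA; apply: is_cderiveZ; exact: is_cderive_wave.
- rewrite ltNge (ltW s0)/=; apply: (@is_cderive_near _ _ (fun s => c0 * wave l s)).
    by near=> y; apply: outgoing_pos; apply: ltW; near: y; exact: lt_nbhsr.
  rewrite outgoing_pos ?ltW// mulrCA; apply: is_cderiveZ; exact: is_cderive_wave.
Unshelve. all: by end_near. Qed.

Lemma doutgoing_derive s : s != 0 -> is_cderive doutgoing s (l ^+ 2 * outgoing s).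
Proof.
move=> s0; have := outgoing_derive s0; move: s0.
rewrite neq_lt => /orP[s0|s0]; rewrite {1}/doutgoing => ds.
- apply: (@is_cderive_near _ _ (fun s => - l * outgoing s)).
    by near=> y; rewrite /doutgoing ifT//; near: y; exact: lt_nbhsl.
  by rewrite s0 in ds; have := is_cderiveZ (- l) ds; rewrite mulrA mulrNN -expr2.
- apply: (@is_cderive_near _ _ (fun s => l * outgoing s)).
    near=> y; rewrite /doutgoing ifN// -leNgt ltW//; near: y; exact: lt_nbhsr.
  by rewrite ltNge (ltW s0)/= in ds; have := is_cderiveZ l ds; rewrite mulrA -expr2.
Unshelve. all: by end_near. Qed.

Lemma doutgoing_continuous s : s != 0 -> {for s, continuous (fun s => Re (doutgoing s))} /\
  {for s, continuous (fun s => Im (doutgoing s))}.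
Proof.
move=> /doutgoing_derive[d1 d2]; split.
- by apply: differentiable_continuous; apply/derivable1_diffP; exact: derivable_is d1.
- by apply: differentiable_continuous; apply/derivable1_diffP; exact: derivable_is d2.
Qed.

(** Being a function of |s|, the kernel is Lipschitz although it is not
    differentiable at 0. *)
Lemma lipschitz_even (f df : R -> R) (C : R) :
  (forall t : R, is_derive t 1 f (df t)) -> (forall t, 0 <= t -> `|df t| <= C) ->
  forall s u : R, `|f `|s| - f `|u| | <= C * `|s - u|.
Proof.
move=> dF dC; have C0 : 0 <= C by apply: le_trans (dC 0 _).
suff H (a b : R) : 0 <= a -> a <= b -> `|f b - f a| <= C * (b - a).
  move=> s u; apply: (@le_trans _ _ (C * `| `|s| - `|u| |)).
    have [su|us] := leP `|s| `|u|.
      by rewrite distrC (le_trans (H _ _ _ su))// ler_wpM2l// distrC ler_norm.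
    by rewrite (le_trans (H _ _ _ (ltW us)))// ler_wpM2l// ler_norm.
  by rewrite ler_wpM2l// ler_dist_dist.
move=> a0 ab; have [|c /andP[ac cb] ->] := @MVT_segment R f df a b ab (fun x _ => dF x).
  by apply: continuous_subspaceT => x; exact: (derive_continuous dF).
by rewrite normrM (ger0_norm (_ : 0 <= b - a)) ?subr_ge0// ler_wpM2r ?subr_ge0// dC// (le_trans a0).
Qed.

Lemma outgoing_lipschitz s u : `|Re (outgoing s) - Re (outgoing u)| <= M * `|s - u| /\
  `|Im (outgoing s) - Im (outgoing u)| <= M * `|s - u|.
Proof.
have dk t : is_cderive (fun t => c0 * wave l t) t (c0 * (l * wave l t)).
  by apply: is_cderiveZ; exact: is_cderive_wave.
have dE t : 0 <= t -> c0 * (l * wave l t) = doutgoing t.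
  by move=> t0; rewrite /doutgoing ltNge t0/= outgoing_pos// mulrCA.
split.
- apply: (lipschitz_even (f := fun t => Re (c0 * wave l t)) (df := fun t => Re (c0 * (l * wave l t)))).
    by move=> t; have [] := dk t.
  by move=> t t0; rewrite dE//; have [] := doutgoing_bounded t.
- apply: (lipschitz_even (f := fun t => Im (c0 * wave l t)) (df := fun t => Im (c0 * (l * wave l t)))).
    by move=> t; have [] := dk t.
  by move=> t t0; rewrite dE//; have [] := doutgoing_bounded t.
Qed.

Lemma outgoing_continuous : ccontinuous outgoing.
Proof.
have lc (f : R -> R) : (forall s u, `|f s - f u| <= M * `|s - u|) -> continuous f.
  move=> L s; apply/cvgrPdist_lt => e e0.
  have M0 : 0 <= M by have [+ _] := outgoing_bounded 0; exact: le_trans.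
  near=> u; apply: le_lt_trans (L _ _) _.
  apply: (@le_lt_trans _ _ ((M + 1) * `|s - u|)); first by rewrite ler_wpM2r// lerDl.
  rewrite mulrC -ltr_pdivlMr ?ltr_wpDl//; near: u.
  by apply: cvgr_dist_lt => //; rewrite divr_gt0// ltr_wpDl.
by split; apply: lc => s u; have [] := outgoing_lipschitz s u.
Unshelve. all: by end_near. Qed.

Lemma outgoing_measurable : cmeasurable setT outgoing.
Proof. exact: ccontinuous_measurable outgoing_continuous. Qed.

Lemma doutgoing_measurable : cmeasurable setT doutgoing.
Proof.
apply: cmeasurableM outgoing_measurable.
have mlt : measurable_fun setT (fun s : R => s < 0) by apply: measurable_fun_ltr.
split.
- under eq_fun do rewrite (fun_if (@Re R)); exact: measurable_fun_ifT.
- under eq_fun do rewrite (fun_if (@Im R)); exact: measurable_fun_ifT.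
Qed.

Definition potential F x := cint setT (fun t => outgoing (x - t) * F t).
Definition dpotential F x := cint setT (fun t => doutgoing (x - t) * F t).

Lemma potential_integrable F x : cintegrable mu setT F ->
  cintegrable mu setT (fun t => outgoing (x - t) * F t).
Proof. by move=> iF; exact: cconv_integrable outgoing_measurable outgoing_bounded iF. Qed.

Lemma potential_derive F x : cintegrable mu setT F -> is_cderive (potential F) x (dpotential F x).
Proof.
move=> iF; apply: (@cconv_derive _ outgoing doutgoing M F x outgoing_measurable doutgoing_measurable
  outgoing_bounded doutgoing_bounded _ _ _ iF).
- by move=> s u; have [] := outgoing_lipschitz s u.
- by move=> s u; have [] := outgoing_lipschitz s u.
- exact: outgoing_derive.
Qed.

Lemma dpotential_continuous F : cintegrable mu setT F -> ccontinuous (dpotential F).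
Proof.
move=> iF; apply: (cconv_continuous doutgoing_measurable doutgoing_bounded) => // s s0.
- by have [] := doutgoing_continuous s0.
- by have [] := doutgoing_continuous s0.
Qed.

Lemma potential_continuous F : cintegrable mu setT F -> ccontinuous (potential F).
Proof. by move=> iF; apply: cderive_continuous => x; exact: potential_derive. Qed.

(** For t < c <= x the kernel factors: G(x - t) = e^(l (x - c)) G(c - t). *)
Lemma potential_right F c x : cintegrable mu setT F -> (forall t, c <= t -> F t = 0) -> c <= x ->
  potential F x = wave l (x - c) * potential F c.
Proof.
move=> iF F0 cx; rewrite /potential -cintZ; last exact: potential_integrable.
apply: eq_cint => t _; have [ct|tc] := leP c t; first by rewrite F0// !mulr0.
rewrite !outgoing_pos ?subr_ge0 ?(ltW tc) ?(le_trans (ltW tc))//.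
have -> : x - t = (x - c) + (c - t) by rewrite addrA subrK.
by rewrite waveD; ring.
Qed.

Lemma potential_left F c x : cintegrable mu setT F -> (forall t, t <= c -> F t = 0) -> x <= c ->
  potential F x = wave l (c - x) * potential F c.
Proof.
move=> iF F0 xc; rewrite /potential -cintZ; last exact: potential_integrable.
apply: eq_cint => t _; have [ct|ct] := leP t c; first by rewrite F0// !mulr0.
rewrite !outgoing_neg ?subr_le0 ?(ltW ct) ?(le_trans xc (ltW ct))// !waveN.
have -> : - (x - t) = (c - x) + - (c - t) by ring.
by rewrite waveD; ring.
Qed.

(** All sources lie on one side of c, where G is an eigenfunction of d/dx. *)
Lemma dpotential_right F c : cintegrable mu setT F -> (forall t, c <= t -> F t = 0) ->
  dpotential F c = l * potential F c.
Proof.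
move=> iF F0; rewrite /potential -cintZ; last exact: potential_integrable.
apply: eq_cint => t _; have [ct|tc] := leP c t; first by rewrite F0// !mulr0.
by rewrite /doutgoing ltNge subr_ge0 (ltW tc)/= mulrA.
Qed.

Lemma dpotential_left F c : cintegrable mu setT F -> (forall t, t <= c -> F t = 0) ->
  dpotential F c = - l * potential F c.
Proof.
move=> iF F0; rewrite /potential -cintZ; last exact: potential_integrable.
apply: eq_cint => t _; have [ct|ct] := leP t c; first by rewrite F0// !mulr0.
by rewrite /doutgoing subr_lt0 ct mulrA.
Qed.

End Outgoing.

(** * Regular distributions *)

Section LocallyIntegrable.
Context {R : realType}.
Implicit Types (f phi : R -> R) (h g : R -> R[i]) (D : set R).
Local Notation mu := (@lebesgue_measure R).

Lemma loc_int_intro f : measurable_fun setT f ->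
  (forall K, compact K -> mu.-integrable K (EFin \o f)) -> locally_integrable setT f.
Proof.
move=> mf fK; split => //; first exact: openT.
by move=> K _ /fK /integrableP[].
Qed.

Lemma loc_int_elim f K : locally_integrable setT f -> compact K ->
  mu.-integrable K (EFin \o f).
Proof.
move=> [mf _ fK] cK; apply/integrableP; split; last exact: fK.
apply/measurable_EFinP; exact: measurable_funTS.
Qed.

Lemma continuous_loc_int f : continuous f -> locally_integrable setT f.
Proof.
move=> cf; apply: loc_int_intro; first exact: continuous_measurable_fun.
move=> K cK; apply: continuous_compact_integrable => //.
exact: continuous_subspaceT.
Qed.

Lemma loc_int_bounded f (g : R -> R) (C : R) : measurable_fun setT g -> (forall x, `|g x| <= C) ->
  locally_integrable setT f -> locally_integrable setT (fun x => g x * f x).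
Proof.
move=> mg gC lf; apply: loc_int_intro; first by apply: measurable_funM => //; case: lf.
move=> K cK; apply: (@rintegrable_bounded _ _ _ mu _ _ _ C) => //.
- exact: compact_measurable.
- exact: measurable_funTS.
- exact: loc_int_elim.
Qed.

Lemma clocD h g : clocally_integrable setT h -> clocally_integrable setT g ->
  clocally_integrable setT (fun x => h x + g x).
Proof.
move=> [h1 h2] [g1 g2]; split.
- by under eq_fun do rewrite cReD; exact: locally_integrableD.
- by under eq_fun do rewrite cImD; exact: locally_integrableD.
Qed.

Lemma cloc_bounded (K : R -> R[i]) h (C : R) : cmeasurable setT K -> cbounded C K ->
  clocally_integrable setT h -> clocally_integrable setT (fun x => K x * h x).
Proof.
move=> [k1 k2] KC [h1 h2].
have b1 s : `|Re (K s)| <= C by have [] := KC s.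
have b2 s : `|Im (K s)| <= C by have [] := KC s.
split.
- under eq_fun do rewrite cReM; apply: locally_integrableB.
    exact: (loc_int_bounded k1 b1).
  exact: (loc_int_bounded k2 b2).
- under eq_fun do rewrite cImM; apply: locally_integrableD.
    exact: (loc_int_bounded k1 b1).
  exact: (loc_int_bounded k2 b2).
Qed.

Lemma clocZ (c : R[i]) h : clocally_integrable setT h ->
  clocally_integrable setT (fun x => c * h x).
Proof. exact: cloc_bounded (cmeasurable_cst _ c) (cbounded_cst c). Qed.

Lemma ccontinuous_cloc h : ccontinuous h -> clocally_integrable setT h.
Proof. by move=> [c1 c2]; split; exact: continuous_loc_int. Qed.

Lemma cintegrable_cloc h : cintegrable mu setT h -> clocally_integrable setT h.
Proof.
by move=> [i1 i2]; split; apply: open_integrable_locally => //; exact: openT.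
Qed.

Lemma cloc_measurable h : clocally_integrable setT h -> cmeasurable setT h.
Proof. by move=> [[m1 _ _] [m2 _ _]]. Qed.

Lemma test_bounded phi : test setT phi -> exists C : R, forall x, `|phi x| <= C.
Proof.
move=> tp; have [M M0 Mp] := test_bounded_supp tp.
have cp : {within `[-M, M], continuous (fun x => `|phi x|)}.
  apply: continuous_subspaceT => x; apply: continuous_comp; last exact: norm_continuous.
  exact: (smooth_continuous (test_smooth tp)).
have [|c _ cmax] := @EVT_max R _ (-M) M _ cp; first by rewrite ge0_cp// ltW.
exists `|phi c| => x; have [Mx|xM] := leP M `|x|; first by rewrite Mp// normr0.
by apply: cmax; rewrite in_itv/= -ler_norml ltW.
Qed.

Lemma test_mul_integrable phi h : test setT phi -> clocally_integrable setT h ->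
  cintegrable mu setT (fun x => (phi x)%:C * h x).
Proof.
move=> tp [h1 h2]; have [M M0 Mp] := test_bounded_supp tp.
have [C pC] := test_bounded tp.
have mp : measurable_fun setT phi.
  by apply: continuous_measurable_fun; exact: (smooth_continuous (test_smooth tp)).
apply: (@cintegrable_support _ `[-M, M]%classic); first exact: measurable_itv.
  move=> x /=; rewrite in_itv/= -ler_norml => /negP; rewrite -ltNge => xM.
  by rewrite Mp ?mul0r// ltW.
have cK : compact `[-M, M]%classic by exact: segment_compact.
have iK f : locally_integrable setT f ->
    mu.-integrable `[-M, M] (EFin \o (fun t => phi t * f t)).
  move=> lf; apply: (@rintegrable_bounded _ _ _ mu _ _ _ C) => //.
  - exact: measurable_funTS.
  - exact: loc_int_elim.
split.
- by have := iK _ h1; congr integrable; apply/funext => t /=; rewrite cReM /= mul0r subr0.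
- by have := iK _ h2; congr integrable; apply/funext => t /=; rewrite cImM /= mul0r addr0.
Qed.

Lemma test_integrable phi : test setT phi -> cintegrable mu setT (fun x => (phi x)%:C).
Proof.
move=> tp; have -> : (fun x => (phi x)%:C) = (fun x => (phi x)%:C * 1).
  by apply/funext => x; rewrite mulr1.
apply: test_mul_integrable => //.
by apply: ccontinuous_cloc; split=> x; exact: cvg_cst.
Qed.

Lemma test_measurable phi : test setT phi -> cmeasurable setT (fun x => (phi x)%:C).
Proof. by move=> /test_integrable; exact: (@cintegrable_measurable _ _ _ mu). Qed.

Lemma regular_Re h phi : Re (regular setT h phi) = Rintegral mu setT (fun x => phi x * Re (h x)).
Proof. by apply: eq_Rintegral => x _; rewrite cReM /= mul0r subr0. Qed.

Lemma regular_Im h phi : Im (regular setT h phi) = Rintegral mu setT (fun x => phi x * Im (h x)).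
Proof. by apply: eq_Rintegral => x _; rewrite cImM /= mul0r addr0. Qed.

Lemma regularD h g phi : test setT phi -> clocally_integrable setT h ->
  clocally_integrable setT g ->
  regular setT (fun x => h x + g x) phi = regular setT h phi + regular setT g phi.
Proof.
move=> tp lh lg; rewrite /regular -cintD; [|exact: test_mul_integrable|exact: test_mul_integrable].
by apply: eq_cint => x _; rewrite mulrDr.
Qed.

Lemma regularZ h (c : R[i]) phi : test setT phi -> clocally_integrable setT h ->
  regular setT (fun x => c * h x) phi = c * regular setT h phi.
Proof.
move=> tp lh; rewrite /regular -cintZ; last exact: test_mul_integrable.
by apply: eq_cint => x _; rewrite mulrCA.
Qed.

Lemma regular_support D h phi : (forall x, ~ D x -> phi x = 0) ->
  regular D h phi = regular setT h phi.
Proof.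
by move=> p0; rewrite /regular [RHS](cint_support (D := D))// => x /p0 ->; rewrite mul0r.
Qed.

Lemma regular_ae_eq D h g : open D -> clocally_integrable setT h ->
  clocally_integrable setT g ->
  (forall phi, test D phi -> regular setT h phi = regular setT g phi) ->
  {ae mu, forall x, D x -> h x = g x}.
Proof.
move=> oD lh lg hg.
have lgN := clocZ (-1) lg; have [d1 d2] := clocD lh lgN.
have hg0 phi : test D phi -> regular setT (fun x => h x + -1 * g x) phi = 0.
  move=> tp; have tT := testT tp.
  by rewrite regularD// regularZ// hg// mulN1r subrr.
have a1 := @vanishing_ae R D (fun x => Re (h x + -1 * g x)) oD d1 _.
have a2 := @vanishing_ae R D (fun x => Im (h x + -1 * g x)) oD d2 _.
have b1 phi : test D phi -> Rintegral mu setT (fun x => phi x * Re (h x + -1 * g x)) = 0.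
  by move=> tp; rewrite -regular_Re hg0.
have b2 phi : test D phi -> Rintegral mu setT (fun x => phi x * Im (h x + -1 * g x)) = 0.
  by move=> tp; rewrite -regular_Im hg0.
apply: ae_impl (ae_and (a1 b1) (a2 b2)) => x [r i] Dx.
apply/eqP; rewrite -subr_eq0 -mulN1r; apply/eqP.
by apply: complex_ext; [exact: r|exact: i].
Qed.

End LocallyIntegrable.

(** * Outgoing solutions *)

Section Solves.
Context {R : realType}.
Variable (l : R[i]).
Hypotheses (l0 : l != 0) (Rel : Re l <= 0).
Implicit Types (F h : R -> R[i]) (x s t : R) (phi : R -> R) (T : @dist R).
Local Notation mu := (@lebesgue_measure R).
Local Notation outgoing := (outgoing l).
Local Notation potential := (potential l).

(** Being the outgoing solution, in the form that the subdomain solves use.  The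
    integrability of the integrand of the convolution is part of the definition
    because it makes the notion linear in T. *)
Definition solves h T := clocally_integrable setT h /\
  forall phi, test setT phi ->
    cintegrable mu setT (fun x => outgoing x * T (fun y => phi (x + y))) /\
    regular setT h phi = conv outgoing T phi.

Lemma solves_eq h T T' : (forall phi, test setT phi -> T phi = T' phi) ->
  solves h T -> solves h T'.
Proof.
move=> TT [lh sh]; split => // phi tp; have [i e] := sh _ tp.
have E : (fun x => outgoing x * T (fun y => phi (x + y))) =
         (fun x => outgoing x * T' (fun y => phi (x + y))).
  by apply/funext => x; rewrite TT//; exact: test_shift.
by split; [rewrite -E|rewrite e /conv E].
Qed.

Lemma solves_lin (c : R[i]) h h' T T' : solves h T -> solves h' T' ->
  solves (fun x => c * h x + h' x) (fun phi => c * T phi + T' phi).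
Proof.
move=> [lh sh] [lh' sh']; split; first by apply: clocD => //; exact: clocZ.
move=> phi tp; have [i e] := sh _ tp; have [i' e'] := sh' _ tp.
have E : (fun x => outgoing x * (c * T (fun y => phi (x + y)) + T' (fun y => phi (x + y)))) =
  (fun x => c * (outgoing x * T (fun y => phi (x + y))) + outgoing x * T' (fun y => phi (x + y))).
  by apply/funext => x; rewrite mulrDr mulrCA.
have iZ := @cintegrableZ _ _ _ mu _ _ c measurableT i.
split; first by rewrite E; exact: (@cintegrableD _ _ _ mu).
rewrite regularD//; last exact: clocZ.
by rewrite regularZ// e e' /conv E cintD// cintZ.
Qed.

Lemma solves0 : solves (fun=> 0) (fun=> 0).
Proof.
split; first by apply: ccontinuous_cloc; split => x; exact: cvg_cst.
move=> phi tp.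
have -> : (fun x => outgoing x * 0) = (fun=> 0) by apply/funext => x; rewrite mulr0.
split; first exact: cintegrable0.
rewrite /regular /conv; apply: eq_cint => x _; by rewrite !mulr0.
Qed.

Lemma solves_sum n (c : 'I_n -> R[i]) (h : 'I_n -> R -> R[i]) (T : 'I_n -> @dist R) :
  (forall i, solves (h i) (T i)) ->
  solves (fun x => \sum_(i < n) c i * h i x) (fun phi => \sum_(i < n) c i * T i phi).
Proof.
elim: n => [|n IH] in c h T *.
  move=> _; under [X in solves X]eq_fun do rewrite big_ord0.
  under [X in solves _ X]eq_fun do rewrite big_ord0.
  exact: solves0.
move=> sh; under [X in solves X]eq_fun do rewrite big_ord_recl.
under [X in solves _ X]eq_fun do rewrite big_ord_recl.
apply: solves_lin; first exact: sh.
exact: (IH (fun i => c (lift ord0 i)) (fun i => h (lift ord0 i)) (fun i => T (lift ord0 i))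
  (fun i => sh (lift ord0 i))).
Qed.

(** By the fundamental lemma, two locally integrable functions that represent the
    same distribution agree almost everywhere. *)
Lemma solves_density h T : solves h T ->
  clocally_integrable setT (density (conv outgoing T)) /\
  {ae mu, forall x, density (conv outgoing T) x = h x}.
Proof.
move=> [lh sh].
have rh : represents h (conv outgoing T) by split => // phi tp; have [] := sh _ tp.
have : represents (density (conv outgoing T)) (conv outgoing T).
  by rewrite /density; case: xgetP => [g _ //|]; move/(_ h).
move=> [ld rd]; split => //.
have := @regular_ae_eq _ setT (density (conv outgoing T)) h openT ld lh.
move=> H; apply: ae_impl (H _) => [x /(_ I)//|phi tp].
by rewrite rd// rh.2.
Qed.

Definition wave_test (a : R[i]) (t : R) (phi : R -> R) (x : R) : R[i] := wave a (x - t) * (phi x)%:C.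

Lemma wave_test_derive a t phi x : smooth phi ->
  is_cderive (wave_test a t phi) x (a * wave_test a t phi x + wave_test a t (derive1 phi) x).
Proof.
move=> sp; have dp := is_cderive_real (smooth_is_derive x sp).
have de : is_cderive (fun x => wave a (x - t)) x (a * wave a (x - t)).
  by apply: is_cderive_shift; exact: is_cderive_wave.
by have := is_cderiveM de dp; rewrite /wave_test mulrA.
Qed.

Lemma wave_test_continuous a t phi : smooth phi -> ccontinuous (wave_test a t phi).
Proof. by move=> sp; apply: cderive_continuous => x; exact: wave_test_derive. Qed.

Variable r : R.
Hypothesis lr : l ^+ 2 = r%:C.

(** The transpose of the operator - u'' + r u, where r = l^2. *)
Definition helm_test (phi : R -> R) (x : R) : R := r * phi x - derive1 (derive1 phi) x.

Lemma test_helm D phi : test D phi -> test D (helm_test phi).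
Proof.
move=> tp; have tp2 := test_derive1 (test_derive1 tp).
have -> : helm_test phi = (fun x => r * phi x + (-1 * derive1 (derive1 phi) x + (fun=> 0) x)).
  by apply/funext => x; rewrite addr0 mulN1r.
apply: test_lin => //; apply: test_lin => //.
split; first exact: smooth_cst.
by exists set0; split; [exact: compact0|exact: sub0set|].
Qed.

(** The antiderivative behind the second Green identity: if a^2 = r, then e^(a x)
    is annihilated by the operator, and so the Wronskian of the exponential and of
    phi has the derivative e^(a x) (r phi - phi''). *)
Lemma wave_test_helm (a : R[i]) t phi x : smooth phi -> a ^+ 2 = l ^+ 2 ->
  is_cderive (fun x => a * wave_test a t phi x + -1 * wave_test a t (derive1 phi) x) x
    (wave_test a t (helm_test phi) x).
Proof.
move=> sp al.
have d1 := is_cderiveZ a (wave_test_derive a t x sp).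
have d2 := is_cderiveZ (-1) (wave_test_derive a t x (smooth_derive1 sp)).
have := is_cderiveD d1 d2; congr is_cderive.
have E : wave_test a t (helm_test phi) x = a ^+ 2 * wave_test a t phi x - wave_test a t (derive1
  (derive1 phi)) x.
  by rewrite al lr /wave_test /helm_test rmorphB rmorphM /=; ring.
by rewrite E; ring.
Qed.

Lemma test_vanish phi : test setT phi -> exists2 M : R, 0 < M &
  forall x, M <= `|x| -> [/\ phi x = 0, derive1 phi x = 0 & derive1 (derive1 phi) x = 0].
Proof.
move=> tp; have tp1 := test_derive1 tp; have tp2 := test_derive1 tp1.
have [M M0 Mp] := test_bounded_supp tp.
have [M1 _ Mp1] := test_bounded_supp tp1.
have [M2 _ Mp2] := test_bounded_supp tp2.
exists (Num.max M (Num.max M1 M2)); first by rewrite lt_max M0.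
by move=> x; rewrite !ge_max => /and3P[a b c]; split; [exact: Mp|exact: Mp1|exact: Mp2].
Qed.

Lemma ge_absN (M x : R) : x <= - M -> M <= `|x|.
Proof. by rewrite lerNr => Mx; rewrite -normrN (le_trans Mx) ?ler_norm. Qed.

Lemma outgoing_shift_if t x : outgoing (x - t) =
  if x < t then - 1 / (2 * l) * wave (- l) (x - t) else - 1 / (2 * l) * wave l (x - t).
Proof.
case: ltP => xt; first by rewrite outgoing_neg// subr_le0 ltW.
by rewrite outgoing_pos// subr_ge0.
Qed.

Lemma two_c0_l : 2 * (- 1 / (2 * l)) * l = -1.
Proof. by field; exact: l0. Qed.

(** Integrate by [wave_test_helm] on both sides of t.  At t the two Wronskians
    differ only by the jump of G', which the constant - 1 / (2 l) makes equal to -1. *)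
Lemma outgoing_fundamental phi t : test setT phi ->
  cint setT (fun x => (helm_test phi x)%:C * outgoing (x - t)) = (phi t)%:C.
Proof.
move=> tp; have sp := test_smooth tp; have [M M0 Mp] := test_vanish tp.
have sh := test_smooth (test_helm tp).
set c := - 1 / (2 * l).
pose F (a : R[i]) x := c * (a * wave_test a t phi x + -1 * wave_test a t (derive1 phi) x).
pose f (a : R[i]) x := c * wave_test a t (helm_test phi) x.
have dF a : a ^+ 2 = l ^+ 2 -> forall x, is_cderive (F a) x (f a x).
  by move=> al x; apply: is_cderiveZ; exact: wave_test_helm.
have cf a : ccontinuous (f a).
  by apply: cderive_continuous => x; apply: is_cderiveZ; exact: wave_test_derive.
have F0 a x : M <= `|x| -> F a x = 0 /\ f a x = 0.
  move=> /Mp[p0 p1 p2]; rewrite /F /f /wave_test /helm_test p0 p1 p2.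
  by rewrite mulr0 subr0 !mulr0 addr0 !mulr0.
have [||||||_ E] := @cbroken_FTC R (F (- l)) (F l) (f (- l)) (f l) t M.
- by apply: dF; rewrite sqrrN.
- exact: dF.
- exact: cf.
- exact: cf.
- by move=> x /ge_absN; exact: F0.
- by move=> x Mx; apply: F0; rewrite (le_trans Mx) ?ler_norm.
transitivity (F (- l) t - F l t); last first.
  rewrite /F /wave_test !subrr !wave0 !mul1r.
  have -> : c * (- l * (phi t)%:C + -1 * (derive1 phi t)%:C) - c * (l * (phi t)%:C + -1 * (derive1 phi
    t)%:C) =
    - (2 * c * l) * (phi t)%:C by ring.
  by rewrite two_c0_l opprK mul1r.
rewrite -E; apply: eq_cint => x _; rewrite outgoing_shift_if /f /wave_test -/c.
by case: ifPn => _; ring.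
Qed.

(** The wave E_b: left-going, starting at b. *)
Definition left_wave (b : R) (x : R) : R[i] := if x < b then wave (- l) (x - b) else 0.

(** The distribution delta'_b - l delta_b. *)
Definition dipole (b : R) : @dist R := fun phi => - (derive1 phi b)%:C - l * (phi b)%:C.

Lemma left_wave_helm phi b : test setT phi ->
  cint setT (fun x => (helm_test phi x)%:C * left_wave b x) = dipole b phi.
Proof.
move=> tp; have sp := test_smooth tp; have [M M0 Mp] := test_vanish tp.
have sh := test_smooth (test_helm tp).
have al : (- l) ^+ 2 = l ^+ 2 by rewrite sqrrN.
have [||||||_ E] := @cbroken_FTC R (fun x => - l * wave_test (- l) b phi x + -1 * wave_test (- l) b
  (derive1 phi) x) (fun=> 0) (wave_test (- l) b (helm_test phi)) (fun=> 0) b M.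
- by move=> x; exact: wave_test_helm.
- by move=> x; exact: is_cderive_cst.
- exact: wave_test_continuous.
- by split => x; exact: cvg_cst.
- move=> x /ge_absN/Mp[p0 p1 p2]; rewrite /wave_test /helm_test p0 p1 p2.
  by rewrite mulr0 subr0 !mulr0 addr0.
- by [].
transitivity (- l * wave_test (- l) b phi b + -1 * wave_test (- l) b (derive1 phi) b - 0); last first.
  by rewrite /wave_test /dipole subrr wave0 !mul1r; ring.
rewrite -E; apply: eq_cint => x _; rewrite /left_wave /wave_test.
by case: ifPn => _; rewrite ?mulr0// mulrC.
Qed.

Lemma left_wave_cloc b : clocally_integrable setT (left_wave b).
Proof.
have -> : left_wave b = (fun x => (\1_(`]-oo, b[%classic) x)%:C * wave (- l) (x - b)).
  apply/funext => x; rewrite /left_wave indicE mem_setE in_itv/=.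
  by case: ifPn => _; rewrite ?mul1r ?mul0r.
apply: (cloc_bounded (C := 1)).
- split; last exact: measurable_cst.
  by apply: measurable_indic; exact: measurable_itv.
- by move=> x /=; rewrite indicE; case: (_ \in _); rewrite /= ?normr0 ?normr1.
- apply: ccontinuous_cloc; apply: cderive_continuous => x.
  by apply: is_cderive_shift; exact: is_cderive_wave.
Qed.

Lemma outgoing_shift_cloc a : clocally_integrable setT (fun x => outgoing (x - a)).
Proof.
apply: ccontinuous_cloc; have [g1 g2] := outgoing_continuous Rel; split => x.
- apply: (@continuous_comp _ _ _ (fun x => x - a) (fun x => Re (outgoing x))); last exact: g1.
  by apply: cvgB => //; exact: cvg_cst.
- apply: (@continuous_comp _ _ _ (fun x => x - a) (fun x => Im (outgoing x))); last exact: g2.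
  by apply: cvgB => //; exact: cvg_cst.
Qed.

Lemma outgoing_cloc : clocally_integrable setT outgoing.
Proof. exact/ccontinuous_cloc/outgoing_continuous. Qed.

(** Translation by a brings the convolution with a singular source carried by a to
    an ordinary integral. *)
Lemma conv_point (psi : R -> R[i]) (h : R -> R[i]) a T phi :
  (forall x, T (fun y => phi (x + y)) = psi (x + a)) ->
  cintegrable mu setT (fun x => outgoing x * psi (x + a)) ->
  cmeasurable setT psi ->
  conv outgoing T phi = cint setT (fun z => outgoing (z - a) * psi z).
Proof.
move=> TE ip mp; rewrite -(@cint_shift _ (fun z => outgoing (z - a) * psi z) a).
- by apply: eq_cint => x _; rewrite TE addrK.
- by under eq_fun do rewrite addrK.
- by apply: cmeasurableM; [exact: cloc_measurable (outgoing_shift_cloc a)|exact: mp].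
Qed.

Lemma test_shiftr phi a : test setT phi -> test setT (fun x => phi (x + a)).
Proof.
by move=> /(test_shift a); congr test; apply/funext => x; rewrite addrC.
Qed.

Lemma solves_delta a : solves (fun x => outgoing (x - a)) (delta a).
Proof.
split; first exact: outgoing_shift_cloc.
move=> phi tp; have tpa := test_shiftr a tp.
have i : cintegrable mu setT (fun x => outgoing x * (phi (x + a))%:C).
  by under eq_fun do rewrite mulrC; apply: test_mul_integrable; [exact: tpa|exact: outgoing_cloc].
split; first exact: i.
rewrite (@conv_point (fun z => (phi z)%:C) (fun=> 0) a)//.
  by apply: eq_cint => x _; rewrite mulrC.
exact: test_measurable.
Qed.

Lemma dipole_shift b phi x : smooth phi ->
  dipole b (fun y => phi (x + y)) = - (derive1 phi (x + b))%:C - l * (phi (x + b))%:C.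
Proof. by move=> sp; rewrite /dipole derive1_shift. Qed.

(** G * (delta'_b - l delta_b) = G'(x - b) - l G(x - b).  For x > b the two terms
    cancel since G' = l G; for x < b they add up to - 2 l G(x - b) = e^(l (b - x)).
    In the weak form the integrand G psi is split accordingly into phi E_b and the
    derivative of a broken antiderivative that is continuous at b. *)
Lemma solves_dipole b : solves (left_wave b) (dipole b).
Proof.
split; first exact: left_wave_cloc.
move=> phi tp; have sp := test_smooth tp; have tp1 := test_derive1 tp.
have [M M0 Mp] := test_vanish tp.
pose psi x := - (derive1 phi x)%:C - l * (phi x)%:C.
have i : cintegrable mu setT (fun x => outgoing x * psi (x + b)).
  have -> : (fun x => outgoing x * psi (x + b)) =
    (fun x => -1 * ((derive1 phi (x + b))%:C * outgoing x) + - l * ((phi (x + b))%:C * outgoing x)).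
    by apply/funext => x; rewrite /psi; ring.
  apply: (@cintegrableD _ _ _ mu) => //; apply: (@cintegrableZ _ _ _ mu) => //.
    by apply: test_mul_integrable; [exact: test_shiftr tp1|exact: outgoing_cloc].
  by apply: test_mul_integrable; [exact: test_shiftr tp|exact: outgoing_cloc].
have mp : cmeasurable setT psi.
  have -> : psi = (fun x => -1 * (derive1 phi x)%:C + - l * (phi x)%:C).
    by apply/funext => x; rewrite /psi; ring.
  apply: cmeasurableD; apply: cmeasurableM; by [exact: cmeasurable_cst|exact: test_measurable].
have E x : dipole b (fun y => phi (x + y)) = psi (x + b) by exact: dipole_shift.
split; first by under eq_fun do rewrite E.
rewrite (@conv_point psi (fun=> 0) b)//.
set c := - 1 / (2 * l).
have [||||||iD D0] := @cbroken_FTC R (fun x => - c * wave_test (- l) b phi x)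
  (fun x => - c * wave_test l b phi x)
  (fun x => - c * (- l * wave_test (- l) b phi x + wave_test (- l) b (derive1 phi) x))
  (fun x => - c * (l * wave_test l b phi x + wave_test l b (derive1 phi) x)) b M.
- by move=> x; apply: is_cderiveZ; exact: wave_test_derive.
- by move=> x; apply: is_cderiveZ; exact: wave_test_derive.
- apply: cderive_continuous => x; apply: is_cderiveZ; apply: is_cderiveD.
    by apply: is_cderiveZ; exact: wave_test_derive.
  by apply: wave_test_derive; exact: smooth_derive1.
- apply: cderive_continuous => x; apply: is_cderiveZ; apply: is_cderiveD.
    by apply: is_cderiveZ; exact: wave_test_derive.
  by apply: wave_test_derive; exact: smooth_derive1.
- move=> x /ge_absN/Mp[p0 p1 p2]; rewrite /wave_test p0 p1.
  by rewrite !mulr0 addr0 mulr0.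
- move=> x Mx; have /Mp[p0 p1 p2] : M <= `|x| by rewrite (le_trans Mx) ?ler_norm.
  by rewrite /wave_test p0 p1 !mulr0 addr0 mulr0.
have ih := test_mul_integrable tp (left_wave_cloc b).
have -> : (fun z => outgoing (z - b) * psi z) = (fun z => (phi z)%:C * left_wave b z +
    (if z < b then - c * (- l * wave_test (- l) b phi z + wave_test (- l) b (derive1 phi) z)
     else - c * (l * wave_test l b phi z + wave_test l b (derive1 phi) z))).
  apply/funext => z; rewrite outgoing_shift_if /left_wave -/c /wave_test /psi.
  have cl : 1 = - (2 * c * l) by rewrite two_c0_l opprK.
  case: ifPn => _; last by ring.
  rewrite -[X in _ = X + _]mul1r cl; ring.
rewrite cintD// D0 /wave_test subrr !wave0 !mul1r subrr addr0.
by [].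
Qed.

Lemma cmeasurable_fun2 (K : R -> R[i]) (g : R * R -> R) : cmeasurable setT K ->
  measurable_fun setT g -> cmeasurable setT (fun z => K (g z)).
Proof.
move=> [k1 k2] mg; split.
- exact: (measurableT_comp (f := fun z => Re (K z)) k1).
- exact: (measurableT_comp (f := fun z => Im (K z)) k2).
Qed.

Lemma regular_potential F phi : cintegrable mu setT F -> test setT phi ->
  regular setT (potential F) phi =
  cint setT (fun t => F t * cint setT (fun x => (phi x)%:C * outgoing (x - t))).
Proof.
move=> iF tp.
have mK : cmeasurable setT (fun z : R * R => outgoing (z.1 - z.2)).
  apply: (cmeasurable_fun2 (outgoing_measurable Rel)).
  by apply: measurable_funB; [exact: measurable_fst|exact: measurable_snd].
have [_ _ E] := cfubini_kernel mK (fun z => outgoing_bounded Rel (z.1 - z.2)) (test_integrable tp) iF.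
rewrite /regular [LHS]E; apply: eq_cint => t _; congr (_ * _).
by apply: eq_cint => x _; rewrite mulrC.
Qed.

Lemma potential_helm F phi : cintegrable mu setT F -> test setT phi ->
  regular setT (potential F) (helm_test phi) = regular setT F phi.
Proof.
move=> iF tp; rewrite regular_potential//; last exact: test_helm.
by apply: eq_cint => t _; rewrite outgoing_fundamental// mulrC.
Qed.

(** Without decay of G at infinity (l may be imaginary), the exchange of the two
    integrals uses that the source has a bounded support: for a given phi only a
    bounded part of G enters. *)
Lemma solves_potential F (N : R) : cintegrable mu setT F -> (forall t, N <= `|t| -> F t = 0) ->
  solves (potential F) (regular setT F).
Proof.
move=> iF FN; split; first exact/ccontinuous_cloc/potential_continuous.
move=> phi tp; have [M M0 Mp] := test_bounded_supp tp.
have [C pC] := test_bounded tp.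
have mphi : cmeasurable setT (fun x => (phi x)%:C).
  exact: test_measurable.
(* phi(x + t) F(t) <> 0 forces |x| <= B. *)
pose B := M + `|N|.
pose psi x := if `|x| <= B then outgoing x else 0.
have psiE x t : outgoing x * ((phi (x + t))%:C * F t) = psi x * ((phi (x + t))%:C * F t).
  rewrite /psi; case: ifPn => //; rewrite -ltNge => Bx.
  have [Nt|tN] := leP N `|t|; first by rewrite FN// !mulr0.
  rewrite Mp ?mul0r ?mulr0//.
  have : `|x| <= `|x + t| + `|t| by rewrite -{1}[x](addrK t) ler_normB.
  have := ler_norm N; move: Bx tN; rewrite /B; lra.
have ipsi : cintegrable mu setT psi.
  have [g1 g2] := outgoing_cloc.
  have cB : compact `[-B, B]%classic by exact: segment_compact.
  have mB : measurable (`[-B, B]%classic : set (measurableTypeR R)) by exact: measurable_itv.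
  apply: (@cintegrable_support _ `[-B, B]%classic) => //.
    by move=> x /=; rewrite in_itv/= -ler_norml /psi => /negP/negbTE ->.
  split.
  - apply: (@eq_integrable _ _ _ mu _ mB _ _ _ (loc_int_elim g1 cB)) => x.
    by rewrite mem_setE in_itv/= -ler_norml /psi => ->.
  - apply: (@eq_integrable _ _ _ mu _ mB _ _ _ (loc_int_elim g2 cB)) => x.
    by rewrite mem_setE in_itv/= -ler_norml /psi => ->.
have mK : cmeasurable setT (fun z : R * R => (phi (z.1 + z.2))%:C).
  apply: (cmeasurable_fun2 (K := fun x => (phi x)%:C)) => //.
  by apply: measurable_funD; [exact: measurable_fst|exact: measurable_snd].
have KC : cbounded C (fun z : R * R => (phi (z.1 + z.2))%:C).
  by move=> z /=; rewrite normr0 pC (le_trans _ (pC 0)).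
have [I _ E] := cfubini_kernel mK KC ipsi iF.
have cE x : outgoing x * regular setT F (fun y => phi (x + y)) =
  psi x * cint setT (fun t => (phi (x + t))%:C * F t).
  have ip : cintegrable mu setT (fun t => (phi (x + t))%:C * F t).
    by apply: test_mul_integrable; [exact: test_shift|exact: cintegrable_cloc].
  by rewrite /regular -(cintZ _ ip) -(cintZ _ ip); apply: eq_cint => t _; exact: psiE.
split; first by under eq_fun do rewrite cE; exact: I.
rewrite (regular_potential iF tp).
transitivity (cint setT (fun x => psi x * cint setT (fun t => (phi (x + t))%:C * F t))); last first.
  by apply: eq_cint => x _; rewrite cE.
rewrite [RHS]E; apply: eq_cint => t _.
have it : cintegrable mu setT (fun x => (phi (x + t))%:C * outgoing x).
  by apply: test_mul_integrable; [exact: test_shiftr|exact: outgoing_cloc].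
have -> : cint setT (fun x => (phi x)%:C * outgoing (x - t)) = cint setT (fun x => (phi (x + t))%:C *
  outgoing x).
  rewrite -(@cint_shift _ _ t).
  - by apply: eq_cint => x _; rewrite addrK.
  - by under eq_fun do rewrite addrK.
  - by apply: cmeasurableM; [exact: mphi|exact: cloc_measurable (outgoing_shift_cloc t)].
have ip' : cintegrable mu setT (fun x => (phi (x + t))%:C * psi x).
  by apply: test_mul_integrable; [exact: test_shiftr|exact: cintegrable_cloc].
rewrite -(cintZ _ it) -(cintZ _ ip'); apply: eq_cint => x _.
by have := psiE x t; rewrite (mulrC (outgoing x)) (mulrC (psi x)) ![_ * F t]mulrC -!mulrA.
Qed.

End Solves.

(** * Uniqueness of representatives *)

Section Representatives.
Context {R : realType}.
Implicit Types (h u : R -> R[i]) (a b x e : R).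
Local Notation mu := (@lebesgue_measure R).

Lemma ae_dense (P : R -> Prop) x e : 0 < e -> {ae mu, forall y, P y} ->
  exists2 y, `|y - x| < e & P y.
Proof.
move=> e0 [N [mN N0 PN]]; apply: contrapT => nP.
have le : (mu (ball x e) <= mu N)%E.
  apply: le_measure; rewrite ?inE//; first exact: measurable_ball.
  move=> y; rewrite /ball/= distrC => yx; apply: PN => Py.
  by apply: nP; exists y.
have mub : mu (ball x e) = (e *+ 2)%:E by rewrite lebesgue_measure_ball// ltW.
have : ((e *+ 2)%:E <= 0 :> \bar R)%E.
  by rewrite -mub; apply: le_trans le _; rewrite [leLHS]N0.
by rewrite lee_fin leNgt mulrn_wgt0.
Qed.

Lemma ae_eq_continuous (f g : R -> R) a e x : {for x, continuous f} -> {for x, continuous g} ->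
  `|x - a| < e -> {ae mu, forall y, `|y - a| < e -> f y = g y} -> f x = g x.
Proof.
move=> cf cg xa fg; apply/eqP; rewrite -subr_eq0; apply/negPn/negP => fgx.
pose d := `|f x - g x|; have d0 : 0 < d by rewrite normr_gt0.
have cfg : {for x, continuous (fun y => f y - g y)} by apply: cvgB.
have /cvgrPdist_lt/(_ _ d0) : (f y - g y) @[y --> x] --> f x - g x by exact: cfg.
move=> /nbhs_ballP[r /= r0 rP].
have m0 : 0 < Num.min r (e - `|x - a|) by rewrite lt_min r0 subr_gt0.
have [y] := ae_dense x m0 fg; rewrite lt_min => /andP[yr ye] fgy.
have := rP y; rewrite /ball/= distrC => /(_ yr).
rewrite fgy ?subrr ?subr0 ?ltxx// -[y](subrK x) -addrA.
by apply: le_lt_trans (ler_normD _ _) _; rewrite -ltrBrDr.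
Qed.

Lemma cderivable_continuous u x : cderivable u x ->
  {for x, continuous (fun t => Re (u t))} /\ {for x, continuous (fun t => Im (u t))}.
Proof.
move=> [d1 d2]; split; apply: differentiable_continuous; apply/derivable1_diffP.
  exact: d1.
exact: d2.
Qed.

Lemma near_ball_dist a e : 0 < e -> \forall x \near a, `|x - a| < e.
Proof.
by move=> e0; apply/nbhs_ballP; exists e => //= x; rewrite /ball/= distrC.
Qed.

(** Two differentiable representatives near a agree almost everywhere, and so
    everywhere near a by continuity; they have the same derivative at a. *)
Lemma deriv_atE h u du a e : 0 < e ->
  {ae mu, forall x, `|x - a| < e -> h x = u x} ->
  (forall x, `|x - a| < e -> is_cderive u x (du x)) -> deriv_at h a = du a.
Proof.
move=> e0 hu du_u; rewrite /deriv_at; case: xgetP => [z _|]; last first.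
  move/(_ (du a)); case; exists e, u; split => //.
    by move=> x /du_u /is_cderiveP[].
  by have /is_cderiveP[_ ->] := du_u a ltac:(by rewrite subrr normr0).
move=> [e' [u' [e'0 hu' du' ->]]].
have aa (d : R) : 0 < d -> `|a - a| < d by rewrite subrr normr0.
have /is_cderiveP[_ <-] := du_u a (aa _ e0).
pose d := Num.min e e'; have d0 : 0 < d by rewrite lt_min e0.
have uu' x : `|x - a| < d -> u' x = u x.
  move=> xd; have [xe xe'] : `|x - a| < e /\ `|x - a| < e'.
    by apply/andP; rewrite -lt_min.
  have ae : {ae mu, forall y, `|y - a| < d -> u' y = u y}.
    apply: ae_impl (ae_and hu hu') => y [hy hy'].
    by rewrite lt_min => /andP[/hy <- /hy' <-].
  have [c1 c2] := cderivable_continuous (du' _ xe').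
  have [c1' c2'] := cderivable_continuous ((is_cderiveP _ _ _).1 (du_u _ xe)).1.
  by apply: complex_ext; [apply: (ae_eq_continuous c1 c1' xd)|apply: (ae_eq_continuous c2 c2' xd)];
    apply: ae_impl ae => y E /E ->.
suff H : is_cderive u' a (cderive u a) by have /is_cderiveP[_ ->] := H.
apply: (@is_cderive_near _ _ u).
  by near=> x; apply: uu'; near: x; exact: near_ball_dist.
by apply/is_cderiveP; split => //; exact: ((is_cderiveP _ _ _).1 (du_u _ (aa _ e0))).1.
Unshelve. all: by end_near. Qed.

Definition cut a b h x : R[i] := if a < x < b then h x else 0.

Lemma cut_itv a b h x : `]a, b[%classic x -> cut a b h x = h x.
Proof. by rewrite /= in_itv/= /cut => ->. Qed.

Lemma cut_out a b h x : ~ `]a, b[%classic x -> cut a b h x = 0.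
Proof. by rewrite /= in_itv/= /cut => /negP/negbTE ->. Qed.

Lemma cut_integrable a b h : cintegrable mu `]a, b[ h -> cintegrable mu setT (cut a b h).
Proof.
move=> [h1 h2]; have mB : measurable (`]a, b[%classic : set (measurableTypeR R)) by exact: measurable_itv.
apply: (cintegrable_support mB); first exact: cut_out.
split.
- by apply: (@eq_integrable _ _ _ mu _ mB _ _ _ h1) => x /set_mem xab; rewrite cut_itv.
- by apply: (@eq_integrable _ _ _ mu _ mB _ _ _ h2) => x /set_mem xab; rewrite cut_itv.
Qed.

Lemma cintegrable_itvS a b a' b' h : a <= a' -> b' <= b ->
  cintegrable mu `]a, b[ h -> cintegrable mu `]a', b'[ h.
Proof.
move=> aa bb [h1 h2].
have S : `]a', b'[ `<=` `]a, b[.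
  by move=> x /=; rewrite !in_itv/= => /andP[/(le_lt_trans aa) -> xb]; exact: lt_le_trans xb bb.
by split; [apply: (@integrableS _ _ _ mu _ _ _ _ _ S h1)|apply: (@integrableS _ _ _ mu _ _ _ _ _ S h2)];
  exact: measurable_itv.
Qed.

Lemma regular_cut a b h phi : regular setT (cut a b h) phi = regular `]a, b[ h phi.
Proof.
rewrite /regular (@cint_support _ `]a, b[%classic).
  by apply: eq_cint => x xab; rewrite cut_itv.
by move=> x /cut_out ->; rewrite mulr0.
Qed.

Lemma regular_ae D h g phi : cmeasurable setT h -> cmeasurable setT g ->
  test D phi -> {ae mu, forall x, D x -> h x = g x} ->
  regular setT h phi = regular setT g phi.
Proof.
move=> mh mg tp hg; have mp := test_measurable (testT tp).
apply: cint_ae; [exact: cmeasurableM|exact: cmeasurableM|].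
apply: ae_impl hg => x E; have [Dx|nDx] := pselect (D x); first by rewrite E.
by rewrite (test_out tp nDx) !mul0r.
Qed.

End Representatives.

(** * Products with an indicator function *)

Section IndicatorMul.
Context {R : realType}.
Implicit Types (a b c L e : R) (g T : @dist R).
Local Notation mu := (@lebesgue_measure R).

(** Near an end c of the interval, both products are given by functions h and h'
    representing the same g, and these agree almost everywhere in ]0, L[. *)
Lemma indicator_mul_local L a b g T T' c : 0 <= a -> b <= L ->
  is_indicator_mul L a b g T -> is_indicator_mul L a b g T' -> c = a \/ c = b ->
  exists2 e, 0 < e & forall phi, test `]c - e, c + e[ phi -> T phi = T' phi.
Proof.
move=> a0 bL [_ _ _ nT] [_ _ _ nT'] cab.
have [e [h [e0 ih gh Th]]] := nT c cab; have [e' [h' [e'0 ih' gh' Th']]] := nT' c cab.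
pose d := Num.min e e'; have d0 : 0 < d by rewrite lt_min e0.
have [de de'] : d <= e /\ d <= e' by rewrite /d !ge_min !lexx orbT.
have sub d' : d <= d' -> `]c - d, c + d[ `<=` `]c - d', c + d'[.
  by move=> dd x /=; rewrite !in_itv/= => /andP[? ?]; apply/andP; split; lra.
pose D := `]c - d, c + d[ `&` `]0, L[.
have oD : open D by apply: openI; exact: interval_open.
have ic := cut_integrable ih; have ic' := cut_integrable ih'.
have hh' : {ae mu, forall x, D x -> cut 0 L h x = cut 0 L h' x}.
  apply: regular_ae_eq => //; [exact: cintegrable_cloc|exact: cintegrable_cloc|].
  move=> phi tp; rewrite !regular_cut -gh ?gh'//.
    by apply: testS tp; apply: setSI; exact: sub.
  by apply: testS tp; apply: setSI; exact: sub.
exists d => // phi tp.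
rewrite Th ?Th'; [|exact: testS (sub _ de') tp|exact: testS (sub _ de) tp].
rewrite -!regular_cut.
have iab := cut_integrable (cintegrable_itvS a0 bL ih).
have iab' := cut_integrable (cintegrable_itvS a0 bL ih').
apply: (@regular_ae _ `]c - d, c + d[%classic) => //.
- exact: (@cintegrable_measurable _ _ _ mu).
- exact: (@cintegrable_measurable _ _ _ mu).
apply: ae_impl hh' => x E xd; have [xab|xab] := pselect (`]a, b[%classic x); last by rewrite !cut_out.
have x0L : `]0, L[%classic x.
  move: xab; rewrite /= !in_itv/= => /andP[ax xb].
  by rewrite (le_lt_trans a0 ax) (lt_le_trans xb bL).
by rewrite !cut_itv//; have := E (conj xd x0L); rewrite !cut_itv.
Qed.

(** A partition of unity writes phi as a sum of five test functions, supported on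
    the left of a, near a, inside ]a, b[, near b and on the right of b; on each of
    them a condition in the definition of the product determines the value. *)
Lemma indicator_mul_unique L a b g T T' phi : 0 <= a -> a < b -> b <= L ->
  is_indicator_mul L a b g T -> is_indicator_mul L a b g T' ->
  test setT phi -> T phi = T' phi.
Proof.
move=> a0 ab bL iT iT' tp.
have [ea ea0 Ea] := indicator_mul_local a0 bL iT iT' (or_introl erefl).
have [eb eb0 Eb] := indicator_mul_local a0 bL iT iT' (or_intror erefl).
have [lT Tin Tout _] := iT; have [lT' Tin' Tout' _] := iT'.
(* Three times d must fit in both neighbourhoods, which leaves room for the steps
   between distances d and 2 d from the ends. *)
pose d := Num.min ea eb / 3.
have d0 : 0 < d by rewrite divr_gt0// lt_min ea0.
have d3 : d * 3 = Num.min ea eb by rewrite divfK.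
have dea : d * 3 <= ea by rewrite d3 ge_min lexx.
have deb : d * 3 <= eb by rewrite d3 ge_min lexx orbT.
have [s1 [S1 s10 s11 _]] := @smooth_step R (a - 2 * d) (a - d) ltac:(lra).
have [s2 [S2 s20 s21 _]] := @smooth_step R (a + d) (a + 2 * d) ltac:(lra).
have [s3 [S3 s30 s31 _]] := @smooth_step R (b - 2 * d) (b - d) ltac:(lra).
have [s4 [S4 s40 s41 _]] := @smooth_step R (b + d) (b + 2 * d) ltac:(lra).
have C (s : R -> R) : smooth s -> smooth (fun x => 1 - s x).
  by move=> Ss; exact: (smoothB (@smooth_cst _ 1) Ss).
have S12 := smoothM S1 S2; have S123 := smoothM S12 S3; have S1234 := smoothM S123 S4.
have t1 : test `]-oo, a[ (fun x => (1 - s1 x) * phi x).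
  apply: (test_mul tp (C _ S1) (K := `]-oo, a - d]%classic)).
  - exact: interval_closed.
  - by move=> x /=; rewrite !in_itv/=; lra.
  - by move=> x /=; rewrite in_itv/= => /negP; rewrite -ltNge => /ltW/s11 ->; rewrite subrr.
have t2 : test `]a - ea, a + ea[ (fun x => s1 x * (1 - s2 x) * phi x).
  apply: (test_mul tp (smoothM S1 (C _ S2)) (K := `[a - 2 * d, a + 2 * d]%classic)).
  - exact: interval_closed.
  - by move=> x /=; rewrite !in_itv/= => /andP[? ?]; apply/andP; split; lra.
  - move=> x /=; rewrite in_itv/= => /negP; rewrite negb_and -!ltNge => /orP[] /ltW.
      by move/s10 ->; rewrite mul0r.
    by move/s21 ->; rewrite subrr mulr0.
have t3 : test `]a, b[ (fun x => s1 x * s2 x * (1 - s3 x) * phi x).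
  apply: (test_mul tp (smoothM S12 (C _ S3)) (K := `[a + d, b - d]%classic)).
  - exact: interval_closed.
  - by move=> x /=; rewrite !in_itv/= => /andP[? ?]; apply/andP; split; lra.
  - move=> x /=; rewrite in_itv/= => /negP; rewrite negb_and -!ltNge => /orP[] /ltW.
      by move/s20 ->; rewrite mulr0 mul0r.
    by move/s31 ->; rewrite subrr mulr0.
have t4 : test `]b - eb, b + eb[ (fun x => s1 x * s2 x * s3 x * (1 - s4 x) * phi x).
  apply: (test_mul tp (smoothM S123 (C _ S4)) (K := `[b - 2 * d, b + 2 * d]%classic)).
  - exact: interval_closed.
  - by move=> x /=; rewrite !in_itv/= => /andP[? ?]; apply/andP; split; lra.
  - move=> x /=; rewrite in_itv/= => /negP; rewrite negb_and -!ltNge => /orP[] /ltW.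
      by move/s30 ->; rewrite mulr0 mul0r.
    by move/s41 ->; rewrite subrr mulr0.
have t5 : test `]b, +oo[ (fun x => s1 x * s2 x * s3 x * s4 x * phi x).
  apply: (test_mul tp S1234 (K := `[b + d, +oo[%classic)).
  - exact: interval_closed.
  - by move=> x /=; rewrite !in_itv/= !andbT; lra.
  - by move=> x /=; rewrite in_itv/= andbT => /negP; rewrite -ltNge => /ltW/s40 ->; rewrite mulr0.
have add p q : test setT p -> test setT q -> T p = T' p -> T q = T' q ->
    T (fun x => 1 * p x + q x) = T' (fun x => 1 * p x + q x) /\ test setT (fun x => 1 * p x + q x).
  by move=> tp' tq ep eq'; split; [rewrite lT// lT'// ep eq'|exact: test_lin].
have [e45 t45] := add _ _ (testT t4) (testT t5) (Eb _ t4)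
  (etrans (Tout _ (or_intror t5)) (esym (Tout' _ (or_intror t5)))).
have [e345 t345] := add _ _ (testT t3) t45 (etrans (Tin _ t3) (esym (Tin' _ t3))) e45.
have [e2345 t2345] := add _ _ (testT t2) t345 (Ea _ t2) e345.
have [e12345 _] := add _ _ (testT t1) t2345
  (etrans (Tout _ (or_introl t1)) (esym (Tout' _ (or_introl t1)))) e2345.
move: e12345; set P := (fun x => _); suff -> : P = phi by [].
by apply/funext => x; rewrite /P; ring.
Qed.

Lemma indicator_mulE L a b g T phi : 0 <= a -> a < b -> b <= L ->
  is_indicator_mul L a b g T -> test setT phi -> indicator_mul L a b g phi = T phi.
Proof.
move=> a0 ab bL iT tp; rewrite /indicator_mul; case: xgetP => [T' _ iT'|]; last by move/(_ T).
exact: (indicator_mul_unique a0 ab bL iT' iT tp).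
Qed.

End IndicatorMul.

(** * Sine modes *)

Section Modes.
Context {R : realType}.
Implicit Types (k L : R) (l : nat) (f : R * R -> R[i]).
Local Notation mu := (@lebesgue_measure R).
Local Notation mu2 := (mu \x mu)%E.

Section Lambda.
Variables (k : R) (l : nat).
Hypotheses (k0 : 0 < k) (kl : k != pi * l%:R) (l_gt0 : (0 < l)%N).

Lemma eta_gt0 : 0 < eta l :> R.
Proof. by rewrite mulr_gt0 ?pi_gt0// ltr0n. Qed.

Lemma lam_sqr : lam k l ^+ 2 = (eta l ^+ 2 - k ^+ 2)%:C.
Proof.
rewrite /lam; case: ifPn => [lt_k|]; last rewrite -leNgt => ke.
  have s2 : Num.sqrt (k ^+ 2 - eta l ^+ 2) ^+ 2 = k ^+ 2 - eta l ^+ 2.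
    by rewrite sqr_sqrtr// subr_ge0 lerXn2r ?nnegrE ?(ltW k0) ?(ltW eta_gt0)// ltW.
  rewrite expr2; apply: complex_ext; rewrite !cE /=; last by ring.
  by rewrite mul0r sub0r -expr2 s2 opprB.
have s2 : Num.sqrt (eta l ^+ 2 - k ^+ 2) ^+ 2 = eta l ^+ 2 - k ^+ 2.
  by rewrite sqr_sqrtr// subr_ge0 lerXn2r ?nnegrE ?(ltW k0) ?(ltW eta_gt0).
by rewrite -rmorphXn /= sqrrN s2.
Qed.

Lemma lam_neq0 : lam k l != 0.
Proof.
have : lam k l ^+ 2 != 0.
  rewrite lam_sqr; apply/eqP => /(congr1 (@Re R)) /= /eqP.
  rewrite subr_eq0 eqrXn2 ?ltW ?eta_gt0//.
  by move: kl; rewrite eq_sym => /negbTE ->.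
by rewrite expf_eq0.
Qed.

Lemma Re_lam_le0 : Re (lam k l) <= 0.
Proof. by rewrite /lam; case: ifP => _ //=; rewrite oppr_le0 sqrtr_ge0. Qed.

End Lambda.

Lemma mode_restrict l f (a b : R) : mode l (restrict_to (strip a b) f) = cut a b (mode l f).
Proof.
apply/funext => x; rewrite /mode /cut; case: ifPn => ab.
  by congr (_ * _); apply: eq_cint => y y01; rewrite /restrict_to mem_set.
rewrite (@eq_cint _ _ _ (fun=> 0)) ?cint0 ?mulr0// => y y01.
rewrite /restrict_to memNset ?mulr0// => -[/= +_].
by rewrite in_itv/= (negbTE ab).
Qed.

Lemma mode_integrable L l f :
  cintegrable mu2 (strip 0 L) f -> cintegrable mu setT (cut 0 L (mode l f)).
Proof.
move=> [f1 f2].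
have mS : measurable (strip 0 L : set (measurableTypeR R * measurableTypeR R)).
  by apply: measurableX; exact: measurable_itv.
pose f0 (z : R * R) := if z \in strip 0 L then f z else 0.
have if0 : cintegrable mu2 setT f0.
  split.
  - have := (@integrable_mkcond _ _ _ mu2 _ _ mS).1 f1; congr integrable.
    by apply/funext => z; rewrite patchE /f0; case: ifP.
  - have := (@integrable_mkcond _ _ _ mu2 _ _ mS).1 f2; congr integrable.
    by apply/funext => z; rewrite patchE /f0; case: ifP.
have ms : cmeasurable setT (fun z : R * R => (sin (eta l * z.2))%:C).
  split; last exact: measurable_cst.
  have c : continuous (fun y : R => sin (eta l * y)).
    move=> y; apply: continuous_comp; last exact: continuous_sin.
    exact: mulrl_continuous.
  apply: (measurableT_comp (f := fun y : R => sin (eta l * y))); last exact: measurable_snd.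
  exact: continuous_measurable_fun.
have bs : cbounded 1 (fun z : R * R => (sin (eta l * z.2) : R)%:C).
  by move=> z /=; rewrite normr0 ler01 ler_norml sin_geN1 sin_le1.
have := @cintegrableM _ _ _ mu2 _ _ _ 1 measurableT ms bs if0.
move/cfubini => [I _ _].
have -> : cut 0 L (mode l f) = (fun x => 2 * cint setT (fun y => (sin (eta l * (x, y).2))%:C * f0 (x, y))).
  apply/funext => x; rewrite /cut /mode; case: ifPn => x0L.
    congr (_ * _); rewrite [RHS](@cint_support _ `]0, 1[%classic).
      by apply: eq_cint => y y01; rewrite /f0 mem_set//; split => //=; rewrite in_itv.
    by move=> y y01; rewrite /f0 memNset ?mulr0// => -[_ /y01].
  rewrite (@eq_cint _ _ _ (fun=> 0)) ?cint0 ?mulr0// => y _.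
  by rewrite /f0 memNset ?mulr0// => -[/= +_]; rewrite in_itv/= (negbTE x0L).
exact: (@cintegrableZ _ _ _ mu).
Qed.

End Modes.

(** * Subdivisions and glued functions *)

Section Subdivisions.
Context {R : realType}.
Implicit Types (L x : R) (J : nat) (b : nat -> R) (u : nat -> R -> R[i]).
Local Notation mu := (@lebesgue_measure R).

Lemma subdivision_le L J b i j : subdivision L J b -> (i <= j)%N -> (j <= J)%N -> b i <= b j.
Proof.
move=> [_ _ bS] ij; elim: j ij => [|j IH]; first by rewrite leqn0 => /eqP ->.
rewrite leq_eqVlt => /predU1P[->//|ij] jJ.
by rewrite (le_trans (IH ij (ltnW jJ)))// ltW// bS.
Qed.

Lemma subdivision_lt L J b i j : subdivision L J b -> (i < j)%N -> (j <= J)%N -> b i < b j.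
Proof.
move=> sb ij jJ; have [_ _ bS] := sb.
by rewrite (lt_le_trans (bS i (leq_trans ij jJ)))// (subdivision_le sb).
Qed.

Lemma subdivision_ge0 L J b i : subdivision L J b -> (i <= J)%N -> 0 <= b i.
Proof. by move=> sb iJ; have [<- _ _] := sb; exact: (subdivision_le sb). Qed.

Lemma subdivision_leL L J b i : subdivision L J b -> (i <= J)%N -> b i <= L.
Proof. by move=> sb iJ; have [_ <- _] := sb; exact: (subdivision_le sb). Qed.

Lemma subdivision_find L J b x : subdivision L J b -> 0 < x < L ->
  (forall j, x <> b j) -> exists2 i, (i < J)%N & b i < x < b i.+1.
Proof.
move=> [b0 bJ _] /andP[x0 xL] xb.
have [|[|i] xi imin] := @ex_minnP (fun j => x < b j); first by exists J; rewrite bJ.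
- by move: xi; rewrite b0 ltNge (ltW x0).
- have iJ : (i < J)%N by rewrite imin// bJ.
  exists i => //; rewrite xi andbT lt_neqAle eq_sym; apply/andP; split; first exact/eqP/xb.
  by rewrite leNgt; apply/negP => /imin; rewrite ltnn.
Qed.

Lemma glueE L J b u i x : subdivision L J b -> (i < J)%N -> b i < x < b i.+1 ->
  glue J b u x = u i.+1 x.
Proof.
move=> sb iJ /andP[bx xb]; rewrite /glue (bigD1 (Ordinal iJ))//= bx xb/=.
rewrite big1 ?addr0// => j /eqP ji; case: ifPn => // /andP[jx xj].
have [ij|ji'|e] := ltngtP i j.
- have := subdivision_le sb ij (ltnW (ltn_ord j)); by rewrite leNgt (lt_trans jx xb).
- have := subdivision_le sb ji' (ltnW iJ); by rewrite leNgt (lt_trans bx xj).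
- by case: ji; apply: val_inj.
Qed.

Lemma ae_nat (P : nat -> R -> Prop) : (forall n, {ae mu, forall x, P n x}) ->
  {ae mu, forall x, forall n, P n x}.
Proof. by move=> aP; exact: ae_foralln. Qed.

Lemma ae_neq (c : R) : {ae mu, forall x, x <> c}.
Proof.
exists [set c]; split; [exact: measurable_set1|exact: lebesgue_measure_set1|].
by move=> x /= /contrapT.
Qed.

Lemma glue_ae L J b u (w : R -> R[i]) : subdivision L J b ->
  (forall i, (i < J)%N -> {ae mu, forall x, b i < x < b i.+1 -> u i.+1 x = w x}) ->
  {ae mu, forall x, `]0, L[%classic x -> glue J b u x = w x}.
Proof.
move=> sb uw.
have A : {ae mu, forall x, forall i, (i < J)%N -> b i < x < b i.+1 -> u i.+1 x = w x}.
  apply: ae_nat => i; have [iJ|iJ] := ltnP i J; last by apply: aeW.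
  by apply: ae_impl (uw _ iJ) => x H _.
have B : {ae mu, forall x, forall j, x <> b j} by apply: ae_nat => j; exact: ae_neq.
apply: ae_impl (ae_and A B) => x [ux xb]; rewrite /= in_itv/= => x0L.
have [i iJ bxb] := subdivision_find sb x0L xb.
by rewrite (glueE _ sb iJ bxb) (ux _ iJ bxb).
Qed.

Lemma cloc0 : clocally_integrable setT (fun=> 0 : R[i]).
Proof. by apply: ccontinuous_cloc; split => x; exact: cvg_cst. Qed.

Lemma cloc_sum n (h : 'I_n -> R -> R[i]) :
  (forall i, clocally_integrable setT (h i)) ->
  clocally_integrable setT (fun x => \sum_(i < n) h i x).
Proof.
elim: n h => [|n IH] h lh.
  by under eq_fun do rewrite big_ord0; exact: cloc0.
under eq_fun do rewrite big_ord_recl; apply: clocD => //.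
exact: IH.
Qed.

Lemma regular_sum n (h : 'I_n -> R -> R[i]) phi : test setT phi ->
  (forall i, clocally_integrable setT (h i)) ->
  regular setT (fun x => \sum_(i < n) h i x) phi = \sum_(i < n) regular setT (h i) phi.
Proof.
move=> tp; elim: n h => [|n IH] h lh.
  rewrite big_ord0 -[RHS](@cint0 R setT); apply: eq_cint => x _.
  by rewrite big_ord0 mulr0.
rewrite big_ord_recl -IH// -regularD//; last exact: cloc_sum.
by apply: eq_cint => x _; rewrite big_ord_recl.
Qed.

Lemma is_cderive_sum n (h : 'I_n -> R -> R[i]) (dh : 'I_n -> R[i]) x :
  (forall i, is_cderive (h i) x (dh i)) ->
  is_cderive (fun x => \sum_(i < n) h i x) x (\sum_(i < n) dh i).
Proof.
elim: n h dh => [|n IH] h dh dhh.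
  by rewrite big_ord0; under eq_fun do rewrite big_ord0; exact: is_cderive_cst.
rewrite big_ord_recl; under eq_fun do rewrite big_ord_recl.
have H := IH (fun i => h (lift ord0 i)) (fun i => dh (lift ord0 i)).
exact: is_cderiveD (dhh ord0) (H (fun i => dhh (lift ord0 i))).
Qed.

Lemma ccontinuous_sum n (h : 'I_n -> R -> R[i]) :
  (forall i, ccontinuous (h i)) -> ccontinuous (fun x => \sum_(i < n) h i x).
Proof.
elim: n h => [|n IH] h ch.
  by under eq_fun do rewrite big_ord0; split => x; exact: cvg_cst.
under eq_fun do rewrite big_ord_recl.
have [c1 c2] := ch ord0; have [c1' c2'] := IH _ (fun i => ch (lift ord0 i)).
split => x.
- under eq_fun do rewrite cReD; apply: cvgD; [exact: c1|exact: c1'].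
- under eq_fun do rewrite cImD; apply: cvgD; [exact: c2|exact: c2'].
Qed.

Lemma ccontinuous_right (h : R -> R[i]) (x : R) : ccontinuous h -> ccvg x^'+ h (h x).
Proof. by move=> [c1 c2]; split; [exact: (cvg_at_right_filter (c1 x))|exact: (cvg_at_right_filter (c2
  x))]. Qed.

Lemma ccontinuous_left (h : R -> R[i]) (x : R) : ccontinuous h -> ccvg x^'- h (h x).
Proof. by move=> [c1 c2]; split; [exact: (cvg_at_left_filter (c1 x))|exact: (cvg_at_left_filter (c2 x))]. Qed.

Lemma cut_cloc (a b : R) (h : R -> R[i]) : clocally_integrable setT h ->
  clocally_integrable setT (cut a b h).
Proof.
move=> lh.
have -> : cut a b h = (fun x => (\1_(`]a, b[%classic) x)%:C * h x).
  apply/funext => x; rewrite /cut indicE mem_setE in_itv/=.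
  by case: ifPn => _; rewrite ?mul1r ?mul0r.
apply: (cloc_bounded (C := 1)) => //.
- split; last exact: measurable_cst.
  by apply: measurable_indic; exact: measurable_itv.
- by move=> x /=; rewrite indicE; case: (_ \in _); rewrite /= ?normr0 ?normr1.
Qed.

Lemma glue_cloc J b u : (forall i, (i < J)%N -> clocally_integrable setT (u i.+1)) ->
  clocally_integrable setT (glue J b u).
Proof.
by move=> lu; apply: cloc_sum => i; apply: cut_cloc; exact: lu.
Qed.

Lemma min_dist n b c : exists2 e : R, 0 < e &
  forall m, (m < n)%N -> b m != c -> e <= `|b m - c|.
Proof.
elim: n => [|n [e e0 eb]]; first by exists 1.
have [bc|bc] := eqVneq (b n) c.
  exists e => // m; rewrite ltnS leq_eqVlt => /predU1P[->|mn]; first by rewrite bc eqxx.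
  exact: eb.
exists (Num.min e `|b n - c|); first by rewrite lt_min e0 normr_gt0 subr_eq0.
move=> m; rewrite ltnS leq_eqVlt => /predU1P[->|mn] mc; first by rewrite ge_min lexx orbT.
by rewrite ge_min eb.
Qed.

Lemma sum_if_ord n (i : nat) (X : nat -> R[i]) : (i < n)%N ->
  \sum_(m < n) (if (m <= i)%N then X m else 0) =
  X i + \sum_(m < n) (if (m < i)%N then X m else 0).
Proof.
move=> iN; rewrite [LHS](bigD1 (Ordinal iN))//= leqnn; congr (_ + _).
rewrite [RHS](bigD1 (Ordinal iN))//= ltnn add0r; apply: eq_bigr => m mi.
by rewrite leq_eqVlt (_ : (m == i :> nat) = false)//; apply/negbTE; exact: mi.
Qed.

End Subdivisions.

(** * The two sweeps *)

Section Sweeps.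
Context {R : realType}.
Variables (L k : R) (J Jt : nat) (b bt : nat -> R) (f : R * R -> R[i]) (l : nat).
Local Notation mu := (@lebesgue_measure R).
Local Notation lam := (lam k l).
Hypothesis Jt0 : (0 < Jt)%N.
Hypotheses (sb : subdivision L J b) (sbt : subdivision L Jt bt).
Hypothesis bbt : forall j m : nat, (0 < j < Jt)%N -> (0 < m < J)%N -> bt j != b m.
Hypotheses (lam0 : lam != 0) (Rel : Re lam <= 0).
Let r : R := eta l ^+ 2 - k ^+ 2.
Hypothesis lr : lam ^+ 2 = r%:C.
Let M := mode l f.
Hypothesis iM : cintegrable mu `]0, L[ M.

Let F m := cut (b m) (b m.+1) M.
(** Amplitude at b_m of the left-going wave that F_m radiates. *)
Let n m := potential lam (F m) (b m).
(** Value at b_i of the right-going field of the pieces on the left of b_i. *)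
Let p i := \sum_(m < J) (if (m < i)%N then potential lam (F m) (b i) else 0).
Let U x := \sum_(m < J) potential lam (F m) x.
Let S x := \sum_(m < J) n m * left_wave lam (b m) x.
Let v := glue J b (forward k b f l).

Let iF m : (m < J)%N -> cintegrable mu setT (F m).
Proof.
move=> mJ; apply: cut_integrable; apply: cintegrable_itvS iM.
  exact: subdivision_ge0 sb (ltnW mJ).
exact: subdivision_leL sb mJ.
Qed.

Let F_bounded m t : (m < J)%N -> L <= `|t| -> F m t = 0.
Proof.
move=> mJ Lt; rewrite /F /cut; case: ifPn => // /andP[bt1 tb].
have t0 : 0 <= t by rewrite (le_trans (subdivision_ge0 sb (ltnW mJ)))// ltW.
move: Lt; rewrite ger0_norm// leNgt (lt_le_trans tb)//.
exact: subdivision_leL sb mJ.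
Qed.

Let F_right m t : b m.+1 <= t -> F m t = 0.
Proof. by move=> bt1; rewrite /F /cut [t < _]ltNge bt1 andbF. Qed.

Let F_left m t : t <= b m -> F m t = 0.
Proof. by move=> bt1; rewrite /F /cut ltNge bt1. Qed.

Lemma subdomain_solveE h T : solves lam h T ->
  clocally_integrable setT (subdomain_solve k l T) /\
  {ae mu, forall x, subdomain_solve k l T x = h x}.
Proof. exact: solves_density. Qed.

(** Convolution with the kernel turns the source - 2 lambda p delta into
    p e^(lambda |x - b_i|), the wave arriving at b_i continued to the right. *)
Lemma forward_step i : (i < J)%N -> deriv_at (forward k b f l i) (b i) = lam * p i ->
  clocally_integrable setT (forward k b f l i.+1) /\
  {ae mu, forall x, forward k b f l i.+1 x =
     - (2 * (lam * p i)) * outgoing lam (x - b i) + potential lam (F i) x}.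
Proof.
move=> iJ dp; apply: subdomain_solveE.
have := solves_lin (- (2 * (lam * p i))) (solves_delta Rel (b i))
  (solves_potential Rel (iF iJ) (fun t => @F_bounded i t iJ)).
apply: solves_eq => phi tp.
by rewrite dp mode_restrict -/M -/(F i); ring.
Qed.

(** At b_(i+1) both the wave entering through b_i and the potential of the i-th
    piece are right-going, so that the derivative is lambda times the value; this
    value is the one radiated by all the pieces up to the i-th. *)
Lemma forward_derive i : (i <= J)%N -> deriv_at (forward k b f l i) (b i) = lam * p i.
Proof.
elim: i => [_|i IH iJ].
  rewrite /p big1 ?mulr0//.
  apply: (@deriv_atE _ _ (fun=> 0) (fun=> 0) _ 1) => //; first exact: aeW.
  by move=> x _; exact: is_cderive_cst.
have [_ fE] := forward_step iJ (IH (ltnW iJ)).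
have [_ _ bS] := sb; have bi := bS _ iJ.
rewrite (@deriv_atE _ _ (fun x => - (2 * (lam * p i)) * outgoing lam (x - b i) + potential lam (F i) x)
  (fun x => - (2 * (lam * p i)) * doutgoing lam (x - b i) + dpotential lam (F i) x) _ (b i.+1 - b i)).
- rewrite dpotential_right//; [|exact: iF|by move=> t; exact: F_right].
  rewrite /doutgoing ltNge subr_ge0 (ltW bi)/= outgoing_pos ?subr_ge0 ?(ltW bi)//.
  have -> : p i.+1 = potential lam (F i) (b i.+1) + wave lam (b i.+1 - b i) * p i.
    rewrite /p; transitivity (\sum_(m < J) (if (m <= i)%N then potential lam (F m) (b i.+1) else 0)).
      by apply: eq_bigr => m _; rewrite ltnS.
    rewrite (@sum_if_ord _ J i (fun m => potential lam (F m) (b i.+1)) iJ); congr (_ + _);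
      rewrite mulr_sumr; apply: eq_bigr => m _.
    case: ifPn => mi; last by rewrite mulr0.
    apply: (@potential_right _ _ Rel) => //; [exact: iF| |exact: ltW].
    move=> t bt1; apply: F_right; apply: le_trans bt1.
    exact: (subdivision_le sb mi (ltnW iJ)).
  by field.
- by rewrite subr_gt0.
- by apply: ae_impl fE => x.
- move=> x xb; apply: is_cderiveD; last by apply: potential_derive => //; exact: iF.
  apply: is_cderiveZ; apply: is_cderive_shift; apply: outgoing_derive.
  rewrite gt_eqF// subr_gt0; move: xb; rewrite ltr_distl => /andP[+ _].
  by rewrite opprB addrCA subrr addr0.
Qed.

Lemma forwardE i : (i < J)%N ->
  clocally_integrable setT (forward k b f l i.+1) /\
  {ae mu, forall x, forward k b f l i.+1 x =
     - (2 * (lam * p i)) * outgoing lam (x - b i) + potential lam (F i) x}.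
Proof. by move=> iJ; apply: forward_step => //; apply: forward_derive; exact: ltnW. Qed.

Let v_cloc : clocally_integrable setT v.
Proof. by apply: glue_cloc => i /forwardE[]. Qed.

(** On ]b_i, b_(i+1)[ the forward sweep has collected the fields of the pieces
    m <= i; a piece m > i contributes to U the left-going wave n_m E_m there. *)
Lemma glue_forward_ae : {ae mu, forall x, `]0, L[%classic x -> v x = U x + -1 * S x}.
Proof.
apply: (glue_ae sb) => i iJ; have [_ fE] := forwardE iJ.
apply: ae_impl fE => x -> /andP[bx xb].
rewrite /U /S [-1 * _]mulr_sumr -big_split/=.
transitivity (\sum_(m < J) (if (m <= i)%N then potential lam (F m) x else 0)).
  rewrite (@sum_if_ord _ J i (fun m => potential lam (F m) x) iJ) addrC; congr (_ + _).
  rewrite outgoing_pos ?subr_ge0 ?ltW// /p.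
  transitivity (wave lam (x - b i) * \sum_(m < J) (if (m < i)%N then potential lam (F m) (b i) else 0)).
    by field.
  rewrite mulr_sumr; apply: eq_bigr => m _; case: ifPn => mi; last by rewrite mulr0.
  symmetry; apply: (@potential_right _ _ Rel) => //; [exact: iF| |exact: ltW].
  move=> t bt1; apply: F_right; apply: le_trans bt1.
  exact: (subdivision_le sb mi (ltnW iJ)).
apply: eq_bigr => m _; case: ifPn => mi.
  rewrite /left_wave ltNge (le_trans (subdivision_le sb mi (ltnW iJ)) (ltW bx))/=.
  by rewrite !mulr0 addr0.
rewrite -ltnNge in mi.
have xm : x < b m by rewrite (lt_le_trans xb)// (subdivision_le sb mi)// ltnW.
rewrite /left_wave xm (@potential_left _ _ Rel _ (b m))//; [|exact: iF|by move=> t; exact: F_left|exact: ltW].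
by rewrite waveN opprB /n; ring.
Qed.

Lemma helm_regular h phi : clocally_integrable setT h -> test `]0, L[ phi ->
  helmholtz k l (regular `]0, L[ h) phi = regular setT h (helm_test r phi).
Proof.
move=> lh tp; have tp2 := test_derive1 (test_derive1 tp).
rewrite /helmholtz /ddx opprK.
rewrite !(@regular_support _ `]0, L[%classic); [|by move=> x; exact: test_out tp|by move=> x;
  exact: test_out tp2].
have i1 := test_mul_integrable (testT tp) lh.
have i2 := test_mul_integrable (testT tp2) lh.
rewrite /regular -(cintZ _ i1) -mulN1r -(cintZ _ i2) -cintD;
  [|exact: (@cintegrableZ _ _ _ mu)|exact: (@cintegrableZ _ _ _ mu)].
apply: eq_cint => x _; rewrite -/r.
have -> : (helm_test r phi x)%:C = r%:C * (phi x)%:C - (derive1 (derive1 phi) x)%:C.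
  by rewrite /helm_test rmorphB rmorphM.
ring.
Qed.

Let U_cloc : clocally_integrable setT U.
Proof.
apply: cloc_sum => m; apply: ccontinuous_cloc; apply: potential_continuous => //.
exact: iF.
Qed.

Let S_cloc : clocally_integrable setT S.
Proof. by apply: cloc_sum => m; apply: clocZ; exact: left_wave_cloc. Qed.

Lemma full_field_helm phi : test `]0, L[ phi ->
  regular setT U (helm_test r phi) = regular `]0, L[ M phi.
Proof.
move=> tp; have tT := testT tp; have th := test_helm r tT.
have lF m : (m < J)%N -> clocally_integrable setT (F m).
  by move=> mJ; apply: cintegrable_cloc; exact: iF.
rewrite regular_sum//; last first.
  by move=> m; apply: ccontinuous_cloc; apply: potential_continuous => //; exact: iF.
transitivity (\sum_(m < J) regular setT (F m) phi).
  by apply: eq_bigr => m _; rewrite potential_helm//; exact: iF.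
rewrite -regular_sum//; last by move=> m; exact: lF.
rewrite -regular_cut; apply: (regular_ae _ _ tp).
- by apply: cloc_measurable; apply: cloc_sum => m; exact: lF.
- by apply: (@cintegrable_measurable _ _ _ mu); exact: cut_integrable.
apply: ae_impl (@glue_ae _ L J b (fun=> M) M sb (fun i _ => aeW _ _)) => [x E x0L|//].
by rewrite cut_itv//; exact: E.
Qed.

Lemma missing_waves_helm phi : test setT phi ->
  regular setT S (helm_test r phi) = \sum_(m < J) n m * dipole lam (b m) phi.
Proof.
move=> tp; have th := test_helm r tp.
rewrite regular_sum//; last by move=> m; apply: clocZ; exact: left_wave_cloc.
apply: eq_bigr => m _; rewrite regularZ//; last exact: left_wave_cloc.
by rewrite /regular left_wave_helm.
Qed.

Let g := residual L k l f v.

(** U accounts for the whole source, so only the operator applied to S remains. *)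
Lemma residualE phi : test `]0, L[ phi ->
  g phi = \sum_(m < J) n m * dipole lam (b m) phi.
Proof.
move=> tp; have tT := testT tp; have th := test_helm r tp.
rewrite /g /residual helm_regular// -/M -(full_field_helm tp) -(missing_waves_helm tT).
have -> : regular setT v (helm_test r phi) = regular setT (fun x => U x + -1 * S x) (helm_test r phi).
  apply: (regular_ae _ _ th glue_forward_ae); apply: cloc_measurable => //.
  by apply: clocD => //; exact: clocZ.
rewrite regularD//; [|exact: testT th|exact: clocZ].
by rewrite regularZ//; [ring|exact: testT th].
Qed.

Let dipoles_in (a b' : R) : @dist R := fun phi =>
  \sum_(m < J) (if a < b m < b' then n m else 0) * dipole lam (b m) phi.

Lemma dipole_out D c phi : test D phi -> ~ D c -> dipole lam c phi = 0.
Proof.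
by move=> tp Dc; rewrite /dipole (test_out (test_derive1 tp) Dc) (test_out tp Dc) mulr0 oppr0 addr0.
Qed.

Lemma dipole_lin c s phi psi : test setT phi -> test setT psi ->
  dipole lam c (fun x => s * phi x + psi x) = s%:C * dipole lam c phi + dipole lam c psi.
Proof.
move=> tp tq; rewrite /dipole derive1_lin ?rmorphD ?rmorphM /=;
  [ring|exact: test_smooth tp|exact: test_smooth tq].
Qed.

(** Beyond the interior points, 0 < b_m excludes bt_0 = 0 and b_m < b_J excludes
    bt_Jt = L. *)
Let interior_neq j m : (j <= Jt)%N -> (m < J)%N -> 0 < b m -> b m != bt j.
Proof.
move=> jJ mJ bm0; have [b0 bJ _] := sb; have [bt0 btJ _] := sbt.
have m0 : (0 < m)%N by case: m mJ bm0 => // _; rewrite b0 ltxx.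
move: jJ; rewrite leq_eqVlt => /predU1P[->|jJ].
  by rewrite btJ -bJ lt_eqF// (subdivision_lt sb).
case: j jJ => [_|j jJ]; first by rewrite bt0 gt_eqF.
by rewrite eq_sym bbt// m0.
Qed.

(** The residual is carried by the points b_m, none of which lies at an end of the
    interval except possibly at 0 or L; near the ends it is represented by 0. *)
Lemma residual_indicator j : (0 < j)%N -> (j <= Jt)%N ->
  is_indicator_mul L (bt j.-1) (bt j) g (dipoles_in (bt j.-1) (bt j)).
Proof.
move=> j0 jJ; have j1J : (j.-1 <= Jt)%N by rewrite (leq_trans (leq_pred _)).
have bt0 := subdivision_ge0 sbt j1J; have btL := subdivision_leL sbt jJ.
split.
- move=> s phi psi tp tq; rewrite /dipoles_in mulr_sumr -big_split/=.
  by apply: eq_bigr => m _; rewrite dipole_lin//; ring.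
- move=> phi tp; rewrite residualE; last first.
    apply: testS tp => x /=; rewrite !in_itv/= => /andP[ax xb].
    by rewrite (le_lt_trans bt0 ax) (lt_le_trans xb btL).
  apply: eq_bigr => m _; case: ifPn => // mab.
  by rewrite (dipole_out tp) ?mulr0//= in_itv/=; exact/negP.
- move=> phi tp; apply: big1 => m _; case: ifPn => [/andP[am mb]|]; last by rewrite mul0r.
  case: tp => tp; rewrite (dipole_out tp) ?mulr0//= in_itv/= ?andbT; apply/negP.
    by rewrite -leNgt ltW.
  by rewrite -leNgt ltW.
- move=> c cE; have [e e0 eb] := min_dist J b c.
  have far m : (m < J)%N -> b m != c -> ~ `]c - e, c + e[%classic (b m).
    move=> mJ mc; rewrite /= in_itv/= -ltr_distl => H.
    by have := eb _ mJ mc; rewrite leNgt H.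
  exists e, (fun=> 0); split => //; first exact: cintegrable0.
  + move=> phi tp; rewrite residualE; last by apply: testS tp => x [].
    rewrite big1; last first.
      move=> m _; rewrite (dipole_out tp) ?mulr0// => -[bme]; rewrite /= in_itv/= => /andP[bm0 _].
      apply: (far _ (ltn_ord m)) bme.
      by case: cE => ->; apply: interior_neq.
    by rewrite /regular -[LHS](@cint0 R `]0, L[%classic); apply: eq_cint => x _; rewrite mulr0.
  + move=> phi tp; rewrite /dipoles_in big1; last first.
      move=> m _; case: ifPn => [/andP[am mb]|]; last by rewrite mul0r.
      rewrite (dipole_out tp) ?mulr0//; apply: far => //.
      by case: cE => ->; [rewrite gt_eqF|rewrite lt_eqF].
    by rewrite /regular -[LHS](@cint0 R `]bt j.-1, bt j[%classic); apply: eq_cint => x _; rewrite mulr0.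
Qed.

(** Value at bt_j of the left-going waves that start on the right of bt_j. *)
Let q j := \sum_(m < J) (if bt j < b m then n m * wave lam (b m - bt j) else 0).
Let w0 j x := \sum_(m < J) (if bt j.-1 < b m < bt j then n m else 0) * left_wave lam (b m) x.

Local Notation bw := (backward L k Jt bt g l).

Lemma backward_step m : (m < Jt)%N -> deriv_at (bw m) (bt (Jt - m)) = - lam * q (Jt - m) ->
  clocally_integrable setT (bw m.+1) /\
  {ae mu, forall x, bw m.+1 x =
     2 * (- lam * q (Jt - m)) * outgoing lam (x - bt (Jt - m)) + w0 (Jt - m) x}.
Proof.
move=> mJ dq; apply: subdomain_solveE.
have j0 : (0 < Jt - m)%N by rewrite subn_gt0.
have jJ : (Jt - m <= Jt)%N by rewrite leq_subr.
have j1 : bt (Jt - m).-1 < bt (Jt - m) by apply: (subdivision_lt sbt) => //; rewrite prednK.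
have := solves_lin (2 * (- lam * q (Jt - m))) (solves_delta Rel (bt (Jt - m)))
  (solves_sum (fun i : 'I_J => if bt (Jt - m).-1 < b i < bt (Jt - m) then n i else 0)
    (fun i => solves_dipole lam0 Rel (b i))).
apply: solves_eq => phi tp.
rewrite (indicator_mulE _ j1 _ (residual_indicator j0 jJ))//.
- by rewrite dq addrC.
- by apply: subdivision_ge0 sbt _; rewrite (leq_trans (leq_pred _)).
- exact: subdivision_leL sbt jJ.
Qed.

(** With j = Jt - m: near bt_(j-1), the solution w^(j) is purely left-going, being
    made of the waves E_i of the b_i in its subdomain and of the wave coming from the
    right end bt_j.  Hence its derivative there is - lambda times its value, to which
    all the b_i on the right of bt_(j-1) contribute. *)
Lemma backward_derive m : (m < Jt)%N -> deriv_at (bw m) (bt (Jt - m)) = - lam * q (Jt - m).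
Proof.
have [b0 bJ _] := sb; have [bt0 btJ _] := sbt.
elim: m => [_|m IH mJ].
  rewrite subn0 /q big1 ?mulr0.
    apply: (@deriv_atE _ _ (fun=> 0) (fun=> 0) _ 1) => //; first exact: aeW.
    by move=> x _; exact: is_cderive_cst.
  move=> i _; rewrite ifN// -leNgt btJ.
  exact: subdivision_leL sb (ltnW (ltn_ord i)).
have [_ wE] := backward_step (ltnW mJ) (IH (ltnW mJ)).
pose j := (Jt - m)%N; have j1 : (Jt - m.+1)%N = j.-1 by rewrite subnS.
have jJ : (j <= Jt)%N by rewrite leq_subr.
have j10 : (0 < j.-1)%N by rewrite -j1 subn_gt0.
have j0 : (0 < j)%N by case: (j) j10.
have bj : bt j.-1 < bt j by apply: (subdivision_lt sbt) => //; rewrite prednK.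
have bj0 : 0 < bt j.-1.
  by rewrite -bt0; apply: (subdivision_lt sbt) => //; rewrite (leq_trans (leq_pred _)).
rewrite j1; set a := bt j.-1 in bj bj0 *.
(* Below the distance from a to the b_m, the waves E_m of the b_m on the right of a
   are unbroken, and u is a smooth representative. *)
have [e e0 eb] := min_dist J b a.
pose d := Num.min e (bt j - a); have d0 : 0 < d by rewrite lt_min e0 subr_gt0.
have bm_neq (i : 'I_J) : b i != a.
  have [bi0|] := ltP 0 (b i); first by apply: interior_neq => //; rewrite (leq_trans (leq_pred _)).
  by move=> bi; rewrite lt_eqF// (le_lt_trans bi).
pose u x := \sum_(i < J) (if a < b i < bt j then n i else 0) * wave (- lam) (x - b i) +
  q j * wave (- lam) (x - bt j).
rewrite (@deriv_atE _ _ u (fun x => - lam * u x) _ d)//.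
- congr (_ * _); rewrite /u /q mulr_suml -big_split/=; apply: eq_bigr => i _.
  rewrite !waveN !opprB; have [ai|ia] := ltP a (b i); last first.
    by rewrite mul0r add0r ltNge (le_trans ia (ltW bj))/= mul0r.
  have [bi|bi|bi] := ltgtP (b i) (bt j).
  + by rewrite mul0r addr0.
  + by rewrite mul0r add0r -mulrA -waveD addrA subrK.
  + by have /eqP := interior_neq jJ (ltn_ord i) (lt_trans bj0 ai).
- apply: ae_impl wE => x ->; rewrite -/j lt_min ltr_distl => /andP[xe].
  rewrite ltr_norml => /andP[_ xj].
  have xbj : x < bt j by lra.
  rewrite outgoing_neg ?subr_le0 ?ltW// /u /w0 addrC; congr (_ + _); last by field.
  apply: eq_bigr => i _; case: ifPn => [/andP[ai _]|_]; last by rewrite !mul0r.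
  rewrite /left_wave ifT//; have := eb _ (ltn_ord i) (bm_neq i).
  rewrite gtr0_norm ?subr_gt0// => eb2; move: xe => /andP[_ xe].
  by rewrite (lt_le_trans xe)// -lerBrDl.
- move=> x _; rewrite /u mulrDr mulr_sumr; apply: is_cderiveD.
    pose h (i : 'I_J) t := (if a < b i < bt j then n i else 0) * wave (- lam) (t - b i).
    have dh i : is_cderive (h i) x (- lam * h i x).
      rewrite /h mulrCA; apply: is_cderiveZ.
      by apply: is_cderive_shift; exact: is_cderive_wave.
    exact: (@is_cderive_sum _ J h (fun i => - lam * h i x) x dh).
  by rewrite mulrCA; apply: is_cderiveZ; apply: is_cderive_shift; exact: is_cderive_wave.
Qed.

Lemma backwardE m : (m < Jt)%N ->
  clocally_integrable setT (bw m.+1) /\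
  {ae mu, forall x, bw m.+1 x =
     2 * (- lam * q (Jt - m)) * outgoing lam (x - bt (Jt - m)) + w0 (Jt - m) x}.
Proof. by move=> mJ; apply: backward_step => //; exact: backward_derive. Qed.

Let w := glue Jt bt (fun j => bw (Jt.+1 - j)).

Let step_index i : (i < Jt)%N -> (Jt.+1 - i.+1 = (Jt - i.+1).+1)%N /\ (Jt - (Jt - i.+1) = i.+1)%N.
Proof. by move=> iJ; rewrite subSS -subSn// subSS subKn. Qed.

Let w_cloc : clocally_integrable setT w.
Proof.
apply: glue_cloc => i iJ; have [-> _] := step_index iJ.
by have [] := @backwardE (Jt - i.+1); rewrite // ltn_subrL Jt0.
Qed.

(** On ]bt_i, bt_(i+1)[ the b_m further right act through the end point, those
    inside directly, and those on the left do not act, because E_m vanishes on the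
    right of b_m. *)
Lemma glue_backward_ae : {ae mu, forall x, `]0, L[%classic x -> w x = S x}.
Proof.
apply: (glue_ae sbt) => i iJ; have [-> e2] := step_index iJ.
have lt : (Jt - i.+1 < Jt)%N by rewrite ltn_subrL Jt0.
have [_ wE] := backwardE lt; rewrite e2 in wE.
apply: ae_impl wE => x -> /andP[bx xb].
rewrite /w0 /= outgoing_neg ?subr_le0 ?ltW// waveN opprB.
transitivity (q i.+1 * wave lam (bt i.+1 - x) +
  \sum_(m < J) (if bt i < b m < bt i.+1 then n m else 0) * left_wave lam (b m) x).
  by congr (_ + _); field.
rewrite /q /S mulr_suml -big_split/=; apply: eq_bigr => m _; rewrite /left_wave.
have [xm|mx] := ltP x (b m); last first.
  by rewrite !mulr0 ltNge (le_trans mx (ltW xb))/= mul0r addr0.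
rewrite (lt_trans bx xm)/= waveN opprB.
have [bi|bi|bi] := ltgtP (b m) (bt i.+1).
- by rewrite mul0r add0r.
- by rewrite mul0r addr0 -mulrA -waveD addrA subrK.
- have x0 : 0 < x by rewrite (le_lt_trans (subdivision_ge0 sbt (ltnW iJ))).
  by have /eqP := interior_neq iJ (ltn_ord m) (lt_trans x0 xm).
Qed.

Lemma double_sweep_ae :
  {ae mu, forall x, `]0, L[%classic x -> double_sweep L k J Jt b bt f l x = U x}.
Proof.
apply: ae_impl (ae_and glue_forward_ae glue_backward_ae) => x [vE wE] x0L.
rewrite /double_sweep -/v -/g -/w vE// wE//; ring.
Qed.

Lemma double_sweep_cloc : clocally_integrable setT (double_sweep L k J Jt b bt f l).
Proof. exact: clocD v_cloc w_cloc. Qed.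

Lemma double_sweep_nonreflecting : nonreflecting L lam (double_sweep L k J Jt b bt f l).
Proof.
pose dU x := \sum_(m < J) dpotential lam (F m) x.
have dUU x : is_cderive U x (dU x).
  by apply: (@is_cderive_sum _ J (fun m => potential lam (F m))
    (fun m => dpotential lam (F m) x)) => m; apply: potential_derive => //; exact: iF.
have cdU : cderive U = dU by apply/funext => x; have /is_cderiveP[] := dUU x.
have cU : ccontinuous U by exact: cderive_continuous dUU.
have cdU' : ccontinuous dU.
  by apply: ccontinuous_sum => m; apply: dpotential_continuous => //; exact: iF.
have [b0 bJ _] := sb.
exists U, (U 0), (dU 0), (U L), (dU L); split.
- by apply: ae_impl double_sweep_ae => x E x0L; apply: E; rewrite /= in_itv.
- by move=> x _; have /is_cderiveP[] := dUU x.
- rewrite cdU; split; [exact: ccontinuous_right|exact: ccontinuous_right|exact: ccontinuous_left|exact: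
  ccontinuous_left].
- rewrite /dU /U mulr_sumr -big_split/= big1// => m _.
  rewrite dpotential_left; [ring|exact: Rel|exact: iF|].
  move=> t t0; apply: F_left; rewrite (le_trans t0)//.
  exact: subdivision_ge0 sb (ltnW (ltn_ord m)).
- rewrite /dU /U mulr_sumr -sumrN -big_split/= big1// => m _.
  rewrite dpotential_right; [ring|exact: Rel|exact: iF|].
  move=> t Lt; apply: F_right; apply: le_trans Lt.
  exact: subdivision_leL sb (ltn_ord m).
Qed.

Lemma double_sweep_helmholtz phi : test `]0, L[ phi ->
  helmholtz k l (regular `]0, L[ (double_sweep L k J Jt b bt f l)) phi =
  regular `]0, L[ M phi.
Proof.
move=> tp; have th := test_helm r tp.
rewrite helm_regular//; last exact: double_sweep_cloc.
rewrite -full_field_helm//; apply: (regular_ae _ _ th double_sweep_ae); apply: cloc_measurable => //.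
exact: double_sweep_cloc.
Qed.

End Sweeps.

Theorem theorem1 (R : realType) (L k : R) (J Jt : nat) (b bt : nat -> R)
    (f : R * R -> R[i]) :
  0 < L -> 0 < k -> (forall l : nat, (0 < l)%N -> k != pi * l%:R) ->
  (0 < J)%N -> (0 < Jt)%N ->
  subdivision L J b -> subdivision L Jt bt ->
  (forall j m : nat, (0 < j < Jt)%N -> (0 < m < J)%N -> bt j != b m) ->
  cintegrable (@lebesgue_measure R \x @lebesgue_measure R)%E (strip 0 L) f ->
  helmholtz_solution L k (double_sweep L k J Jt b bt f) f.
Proof.
move=> L0 k0 kl J0 Jt0 sb sbt bbt fi l l0.
have lam0 := lam_neq0 k0 (kl l l0) l0.
have lr := lam_sqr k0 l0; have Rel := Re_lam_le0 k l.
have iM : cintegrable (@lebesgue_measure R) `]0, L[ (mode l f).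
  have [m1 m2] := mode_integrable l fi; split.
  - apply: (@eq_integrable _ _ _ (@lebesgue_measure R) _ (measurable_itv _)
    (fun x => (Re (cut 0 L (mode l f) x))%:E)).
      by move=> x; rewrite inE => /cut_itv ->.
    by apply: (@integrableS _ _ _ (@lebesgue_measure R) setT) => //; exact: measurable_itv.
  - apply: (@eq_integrable _ _ _ (@lebesgue_measure R) _ (measurable_itv _)
    (fun x => (Im (cut 0 L (mode l f) x))%:E)).
      by move=> x; rewrite inE => /cut_itv ->.
    by apply: (@integrableS _ _ _ (@lebesgue_measure R) setT) => //; exact: measurable_itv.
split.
- have [d1 d2] := double_sweep_cloc Jt0 sb sbt bbt lam0 Rel lr iM.
  have H (u : R -> R) : locally_integrable setT u -> locally_integrable `]0, L[ u.
    move=> [u1 u2 u3]; split.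
    + exact: measurable_funTS.
    + exact: interval_open.
    + by move=> K _ cK; exact: u3.
  by split; exact: H.
- by move=> phi; exact: double_sweep_helmholtz.
- exact: double_sweep_nonreflecting.
Qed.
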